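(* Let $G=(V,E)$ be a connected acyclic graph with vertex set $V=\{1,2,\ldots,n\}$, and let $\widetilde{E}=\{(i,j):\{i,j\}\in E,\ i<j\}$. Let $\mathbf{Q}:\widetilde{E}\to\mathcal{B}(\mathcal{H})$ be a function taking each $(i,j)\in\widetilde{E}$ to a contraction $\mathbf{Q}(i,j)$. Let $T_1,\ldots,T_n$ be strict contractions on $\mathcal{H}$ such that $(T_1,\ldots,T_n)$ is $(G,\mathbf{Q},R)$-commuting. Then there is a Hilbert space $\mathcal{K}$ containing $\mathcal{H}$, a function $\overline{\mathbf{Q}}:\widetilde{E}\to\mathcal{B}(\mathcal{K})$ such that for each $(i,j)\in\widetilde{E}$, $\overline{\mathbf{Q}}(i,j)$ is an isometric lift of $\mathbf{Q}(i,j)$, and isometric lifts $V_1,\ldots,V_n\in\mathcal{B}(\mathcal{K})$ of $T_1,\ldots,T_n$ respectively, such that $(V_1,\ldots,V_n)$ is $(G,\overline{\mathbf{Q}},R)$-commuting. Moreover, if for any $(i,j)\in\widetilde{E}$, $\mathbf{Q}(i,j)$ is a unitary, then we can choose $\overline{\mathbf{Q}}(i,j)=\mathbf{Q}(i,j)\oplus I$ on $\mathcal{K}=\mathcal{H}\oplus(\mathcal{K}\ominus\mathcal{H})$.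
   Context: All Hilbert spaces are complex; $\mathcal{B}(\mathcal{H})$ is the algebra of bounded linear operators on $\mathcal{H}$; containment of Hilbert spaces means containment as a closed linear subspace; a contraction is an operator of norm at most one, and a strict contraction is an operator of norm strictly less than one. Graphs are finite and simple (edges are unordered pairs of distinct vertices); acyclic means containing no cycle as a subgraph. An operator $B\in\mathcal{B}(\mathcal{K})$ is a lift of $A\in\mathcal{B}(\mathcal{H})$, $\mathcal{H}\subseteq\mathcal{K}$, if $\mathcal{H}$ is invariant under $B^*$ and $B^*|_{\mathcal{H}}=A^*$; it is an isometric lift if in addition $B$ is an isometry. For a graph $G=(V,E)$ with $V=\{1,\ldots,n\}$, $\widetilde{E}=\{(i,j):\{i,j\}\in E,\ i<j\}$, and a function $\mathbf{Q}$ from $\widetilde{E}$ to the contractions in $\mathcal{B}(\mathcal{H})$, a tuple $(T_1,\ldots,T_n)$ of bounded operators on $\mathcal{H}$ is called $(G,\mathbf{Q},R)$-commuting if $T_iT_j=T_jT_i\mathbf{Q}(i,j)$ for all $(i,j)\in\widetilde{E}$. *)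

(* Defs.v *)
From HB Require Import structures.
From mathcomp Require Import all_boot all_order all_algebra.
From mathcomp Require Import complex.
From mathcomp Require Import all_classical all_reals all_analysis.

Set Implicit Arguments.
Unset Strict Implicit.
Unset Printing Implicit Defensive.

Import Order.TTheory GRing.Theory Num.Theory.
Import numFieldNormedType.Exports.

Local Open Scope classical_set_scope.
Local Open Scope ring_scope.
Local Open Scope complex_scope.

(** The inner product is linear in its first argument and conjugate-linear in
  the second one. The library has no notion of Hilbert space: it is a complete
  normed space over [R[i]] whose norm comes from an inner product. The library
  norm [`|x|] on such a space has values in [R[i]]. *)

HB.mixin Record CompleteNormedModule_isHilbert (R : realType) H
    of CompleteNormedModule R[i] H := {
  hdot : {dot H for Num.conj} ;
  hdot_norm : forall x : H, `|x| ^+ 2 = hdot x x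
}.

#[short(type="hilbertType")]
HB.structure Definition Hilbert (R : realType) :=
  {H of CompleteNormedModule R[i] H & CompleteNormedModule_isHilbert R H}.

Record bounded_op (R : realType) (H K : hilbertType R) := BoundedOp {
  bounded_op_lin :> {linear H -> K} ;
  bounded_opP : exists M : R, forall x : H,
    `|bounded_op_lin x| <= M%:C * `|x|
}.

Notation "''B' ( H )" := (bounded_op H H) (format "''B' ( H )") : type_scope.

Section Operators.
Context {R : realType}.
Implicit Types H K : hilbertType R.

(* [complex.Re] only casts the norm, a nonnegative real in [R[i]], to [R]. *)
Definition opnorm H K (T : bounded_op H K) : R :=
  sup [set complex.Re `|T x| | x in [set x : H | `|x| <= 1]].

Definition contraction_op H (T : 'B(H)) : Prop := opnorm T <= 1.

Definition strict_contraction_op H (T : 'B(H)) : Prop := opnorm T < 1.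

(* [S = T^*]; such an [S] exists and is unique, by Riesz's theorem. *)
Definition is_adjoint H (T S : 'B(H)) : Prop :=
  forall x y : H, hdot (T x) y = hdot x (S y).

Definition isometry_op H (V : 'B(H)) : Prop :=
  isometry (@hdot R H) (@hdot R H) V.

Definition unitary_op H (U : 'B(H)) : Prop :=
  exists Us : 'B(H), [/\ is_adjoint U Us, cancel U Us & cancel Us U].

(** The inclusion of [H] in [K] as a closed subspace is a linear map
  [iota : H -> K] preserving inner products; its range is closed because [H]
  is complete. *)

Definition hilbert_inclusion H K (iota : {linear H -> K}) : Prop :=
  isometry (@hdot R K) (@hdot R H) iota.

Definition is_lift H K (iota : {linear H -> K}) (A : 'B(H)) (B : 'B(K))
    : Prop :=
  exists (As : 'B(H)) (Bs : 'B(K)),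
    [/\ is_adjoint A As, is_adjoint B Bs &
        forall h : H, Bs (iota h) = iota (As h)].

Definition is_isometric_lift H K (iota : {linear H -> K}) (A : 'B(H))
    (B : 'B(K)) : Prop :=
  is_lift iota A B /\ isometry_op B.

(* [B = A (+) I] on [K = H (+) (K (-) H)] *)
Definition is_sum_id H K (iota : {linear H -> K}) (A : 'B(H)) (B : 'B(K))
    : Prop :=
  (forall h : H, B (iota h) = iota (A h)) /\
  (forall k : K, (forall h : H, hdot k (iota h) = 0) -> B k = k).

End Operators.

Record simple_graph (V : finType) := SimpleGraph {
  adj :> rel V ;
  adj_sym : symmetric adj ;
  adj_irrefl : irreflexive adj
}.

Definition connected_graph (V : finType) (G : simple_graph V) : Prop :=
  (0 < #|V|)%N /\ forall x y : V, connect G x y.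

(* [c] is a graph cycle when it is a [G]-cycle without repetition and with at
   least three vertices: the sequences [[:: x; y]] with [x] and [y] adjacent
   also satisfy [ucycle G]. *)
Definition acyclic_graph (V : finType) (G : simple_graph V) : Prop :=
  forall c : seq V, ucycle G c -> (size c < 3)%N.

Section OrientedEdges.
Context {n : nat}.

Definition oedge (G : simple_graph 'I_n) : Type :=
  {e : 'I_n * 'I_n | G e.1 e.2 && (e.1 < e.2)%N}.

Definition src (G : simple_graph 'I_n) (e : oedge G) : 'I_n := (val e).1.
Definition tgt (G : simple_graph 'I_n) (e : oedge G) : 'I_n := (val e).2.

Definition GQR_commuting (R : realType) (H : hilbertType R)
    (G : simple_graph 'I_n) (Q : oedge G -> 'B(H)) (T : 'I_n -> 'B(H))
    : Prop :=
  forall (e : oedge G) (x : H),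
    T (src e) (T (tgt e) x) = T (tgt e) (T (src e) (Q e x)).

End OrientedEdges.

(* Main.v *)
Require Import Defs.
From HB Require Import structures.
From mathcomp Require Import all_boot all_order all_algebra.
From mathcomp Require Import complex ring lra.
From mathcomp Require Import all_classical all_reals all_analysis.

(** A tree is assembled from its edges. For a single edge the statement is a
  version of Ando's dilation theorem, and the edges can be glued because the
  part of an isometric lift of a strict contraction [T] that is generated by [H]
  depends only on [T].

  To begin with, the operators [Q] may be taken isometric: on [H (+) l2(H)] each
  [Q] has an isometric lift with [Q] in the corner ([Q (+) I] when [Q] is
  unitary), and the operators [T i (+) 0] satisfy the same relations with these
  lifts, because only the corner counts ([isometric_extension_ex]). From there
  on every [Q] is extended to larger spaces by the identity ([ext_id]).

  For one edge with [T1 T2 = T2 T1 Q], let [V1] and [V2] be isometric lifts of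
  Schaffer's type. Both [V1 V2] and [V2 V1 (Q (+) I)] are isometric lifts of the
  strict contraction [C = T1 T2]: they act alike except for the vectors
  [(D1 T2 h, D2 h)] and [(D2 T1 Q h, D1 Q h)] that they write next to [h], and
  these vectors have the same norm. A unitary [U] on the complement of [H] that
  carries the first to the second and commutes with the shift gives
  [U V1 V2 = V2 V1 (Q (+) I) U], so that [U V1] and [V2 U^-1] satisfy the
  relation ([edge_lift]). As [1 - C^* C] is invertible, [U] is explicit: it is
  Halmos's dilation of a partial isometry ([edge_unitary_ex]).

  For the gluing, let [V] on [K] and [W] on [M] be isometric lifts of the same
  strict contraction [T]. On the smallest reducing subspace containing [H], both
  are the unilateral shift on [l2(H)], and the embedding of [H] in [l2(H)] is
  the same for both ([model_ex]); this uses that [1 - T T^*] is invertible and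
  that the powers of [T^*] tend to [0]. Hence [M] embeds in [K (+) M] by an
  isometry that identifies the two copies of [H] and whose range reduces
  [V (+) W] ([amalgam_embedding]). The other operator of the edge is carried
  along by this embedding and extended by the identity ([amalgam]).

  In a tree, a vertex adjacent to a connected set [A] of vertices has only one
  neighbour [i] in [A]. Adding it to [A] brings in a single new relation, which
  is obtained by gluing along the lift of [T i] while all other operators are
  extended by the identity ([lifted_on_add]).

  The computations use the real part [rdot] of the inner product; adjoints come
  from Riesz's theorem, and the square roots and inverses from explicit
  iterations ([riesz], [op_sqrt_ex], [op_inverse_ex]). *)

Set Implicit Arguments.
Unset Strict Implicit.
Unset Printing Implicit Defensive.

Import Order.TTheory GRing.Theory Num.Theory.
Import numFieldNormedType.Exports.

Local Open Scope classical_set_scope.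
Local Open Scope ring_scope.
Local Open Scope complex_scope.

(** * Hilbert spaces from a real inner product *)

Lemma scale_complexE (R : realType) (E : lmodType R[i]) (c : R[i]) (x : E) :
  c *: x = (complex.Re c)%:C *: x + (complex.Im c)%:C *: ('i *: x).
Proof. by rewrite scalerA -scalerDl mulrC -complexE. Qed.

(** A complex Hilbert space is determined by the real part [ip] of its inner
  product, a real inner product for which multiplication by ['i] is isometric:
  the complex product is recovered in [cdot] below. Building spaces from [ip]
  reduces every verification to identities and limits of real numbers.
  Completeness is asked for sequences only. *)
HB.factory Record Lmodule_isHilbert (R : realType) E of GRing.Lmodule R[i] E := {
  ip : E -> E -> R ;
  ipC : forall x y, ip x y = ip y x ;
  ipDl : forall x y z, ip (x + y) z = ip x z + ip y z ;
  ipZl : forall (c : R) x y, ip (c%:C *: x) y = c * ip x y ;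
  ipi : forall x y, ip ('i *: x) ('i *: y) = ip x y ;
  ip_gt0 : forall x, x != 0 -> 0 < ip x x ;
  ip_complete : forall u : nat -> E,
    (forall e, 0 < e -> exists N, forall m n, (N <= m)%N -> (N <= n)%N ->
       ip (u m - u n) (u m - u n) < e) ->
    exists l, forall e, 0 < e -> exists N, forall n, (N <= n)%N ->
       ip (u n - l) (u n - l) < e
}.

HB.builders Context R E of Lmodule_isHilbert R E.

Let ipDr x y z : ip x (y + z) = ip x y + ip x z.
Proof. by rewrite ipC ipDl !(ipC x). Qed.

Let ipZr (c : R) x y : ip x (c%:C *: y) = c * ip x y.
Proof. by rewrite ipC ipZl ipC. Qed.

Let real_scaleN1 (x : E) : - x = (- 1 : R)%:C *: x.
Proof. by rewrite rmorphN1 scaleN1r. Qed.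

Let ipNr x y : ip x (- y) = - ip x y.
Proof. by rewrite real_scaleN1 ipZr mulN1r. Qed.

Let ipNl x y : ip (- x) y = - ip x y.
Proof. by rewrite real_scaleN1 ipZl mulN1r. Qed.

Let ii (x : E) : 'i *: ('i *: x) = - x.
Proof. by rewrite scalerA -expr2 sqr_i scaleN1r. Qed.

Let ipil x y : ip ('i *: x) y = - ip x ('i *: y).
Proof. by rewrite -(ipi x) ii ipNr opprK. Qed.

Let ipZZ (c : R[i]) x y : ip (c *: x) y =
  complex.Re c * ip x y - complex.Im c * ip x ('i *: y).
Proof. by rewrite scale_complexE ipDl !ipZl ipil mulrN. Qed.

Definition cdot (x y : E) : R[i] := (ip x y) +i* (ip x ('i *: y)).

Let cdot_linear_l (z : E) : linear (cdot^~ z).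
Proof.
move=> c x y; rewrite /cdot; apply/eqP; rewrite eq_complex !ipDl !ipZZ ii ipNr.
by case: c => a b /=; apply/andP; split; apply/eqP; ring.
Qed.

Let cdotC (x y : E) : cdot x y = (cdot y x)^*.
Proof. by rewrite /cdot /= -ipil (ipC y x) (ipC ('i *: y)). Qed.

Let cdot_linear_r (z : E) : linear_for (Num.conj \; *%R) (cdot z).
Proof.
move=> c x y; rewrite cdotC cdot_linear_l (cdotC z x) (cdotC z y).
by rewrite [LHS]rmorphD [X in X + _]rmorphM.
Qed.

HB.instance Definition _ := @bilinear_isBilinear.Build R[i] E E R[i]
  *%R (Num.conj \; *%R) cdot (cdot_linear_l, cdot_linear_r).

Let cdot_herm (x y : E) : cdot x y = (-1) ^+ false * Num.conj (cdot y x).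
Proof. by rewrite expr0 mul1r cdotC. Qed.

HB.instance Definition _ :=
  @isHermitianSesquilinear.Build R[i] E false Num.conj cdot cdot_herm.

Let cdot_self x : cdot x x = (ip x x)%:C.
Proof.
congr (_ +i* _); have := ipil x x; rewrite ipC => /eqP.
by rewrite -addr_eq0 -mulr2n mulrn_eq0 /= => /eqP.
Qed.

Let cdot_gt0 x : x != 0 -> 0 < cdot x x.
Proof. by move=> x0; rewrite cdot_self ltcR ip_gt0. Qed.

HB.instance Definition _ := @isDotProduct.Build R[i] E cdot cdot_gt0.

Let ip0l y : ip 0 y = 0.
Proof. by have := ipZl 0 0 y; rewrite scaler0 mul0r. Qed.

Let ip_ge0 x : 0 <= ip x x.
Proof.
have [->|/ip_gt0/ltW//] := eqVneq x 0.
by rewrite ip0l.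
Qed.

Let nrm x := Num.sqrt (ip x x).

Let nrm_sqr x : nrm x ^+ 2 = ip x x.
Proof. by rewrite sqr_sqrtr. Qed.

Let nrm_ge0 x : 0 <= nrm x. Proof. exact: sqrtr_ge0. Qed.

Let ip_sqD x y : ip (x + y) (x + y) = ip x x + 2 * ip x y + ip y y.
Proof. by rewrite ipDl !ipDr (ipC y x); ring. Qed.

(** Cauchy-Schwarz, from the vector [|y| x - |x| y]. *)
Let ip_cauchy x y : ip x y <= nrm x * nrm y.
Proof.
have [->|y0] := eqVneq y 0.
  by rewrite ipC ip0l; exact: mulr_ge0.
have ny : 0 < nrm y by rewrite sqrtr_gt0 ip_gt0.
have [->|x0] := eqVneq x 0.
  by rewrite ip0l; exact: mulr_ge0.
have nx : 0 < nrm x by rewrite sqrtr_gt0 ip_gt0.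
have := ip_ge0 ((nrm y)%:C *: x + (- nrm x)%:C *: y).
rewrite ip_sqD !(ipZl, ipZr) -!nrm_sqr => h.
have : 0 <= (nrm x * nrm y) * (nrm x * nrm y - ip x y) by nra.
by rewrite pmulr_rge0 ?mulr_gt0// subr_ge0.
Qed.

Let nrmD x y : nrm (x + y) <= nrm x + nrm y.
Proof.
rewrite -ler_sqr ?nnegrE ?addr_ge0// nrm_sqr ip_sqD -!nrm_sqr.
by have := ip_cauchy x y; nra.
Qed.

Let nrmZ (c : R[i]) x : (nrm (c *: x))%:C = `|c| * (nrm x)%:C.
Proof.
rewrite normc_def -rmorphM -sqrtrM ?addr_ge0 ?sqr_ge0//; congr (Num.sqrt _)%:C.
have xix : ip x ('i *: x) = 0.
  have := ipil x x; rewrite ipC => /eqP.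
  by rewrite -addr_eq0 -mulr2n mulrn_eq0 /= => /eqP.
rewrite scale_complexE ip_sqD !(ipZl, ipZr) ipi xix.
by ring.
Qed.

Let nrmC_D x y : (nrm (x + y))%:C <= (nrm x)%:C + (nrm y)%:C.
Proof. by rewrite -rmorphD lecR nrmD. Qed.

Let nrmC_eq0 x : (nrm x)%:C = 0 -> x = 0.
Proof.
move=> /complexI n0; apply/eqP; apply: contraT => /ip_gt0.
by rewrite -nrm_sqr n0 expr0n ltxx.
Qed.

HB.instance Definition _ := Lmodule_isNormed.Build R[i] E nrmC_D nrmZ nrmC_eq0.

Let normE x : `|x| = (nrm x)%:C. Proof. by []. Qed.

Let normsq x : `|x| ^+ 2 = (ip x x)%:C.
Proof. by rewrite normE -rmorphXn nrm_sqr. Qed.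

Let norm_lt x (e : R) : 0 < e -> (`|x| < e%:C) = (ip x x < e ^+ 2).
Proof.
by move=> e0; rewrite normE ltcR -[RHS]ltr_sqrt ?exprn_gt0// sqrtr_sqr gtr0_norm.
Qed.

(** The filter contains a ball of radius [1 / (n + 1)] for every [n]; the centres
  [u n] of these balls form a Cauchy sequence with the same limit. *)
Let cauchy_complete (F : set_system E) : ProperFilter F -> cauchy F -> cvg F.
Proof.
move=> FF /cauchyP Fc.
have pos n : 0 < (n.+1%:R^-1 : R) by rewrite invr_gt0.
have posC n : 0 < (n.+1%:R^-1 : R)%:C by rewrite ltcR.
have /choice[u uF] : forall n, exists x, F (ball x (n.+1%:R^-1 : R)%:C).
  by move=> n; apply: Fc.
have near_u n x : ball (u n) (n.+1%:R^-1 : R)%:C x ->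
    ip (u n - x) (u n - x) < n.+1%:R^-1 ^+ 2.
  by rewrite -ball_normE /= norm_lt.
have sq2 x y z : ip (x - z) (x - z) <=
    2 * ip (x - y) (x - y) + 2 * ip (y - z) (y - z).
  have -> : x - z = (x - y) + (y - z) by rewrite addrA subrK.
  move: (x - y) (y - z) => a b.
  by have := ip_ge0 (a - b); rewrite !ip_sqD ipNl !ipNr; lra.
have small e : 0 < e -> exists N, forall n, (N <= n)%N -> n.+1%:R^-1 ^+ 2 < e :> R.
  move=> e0; exists (Num.truncn e^-1) => n Nn.
  have n1 : e^-1 < n.+1%:R.
    by rewrite (lt_le_trans (truncnS_gt _))// ler_nat ltnS.
  have ne : n.+1%:R^-1 < e by rewrite invf_plt ?posrE.
  apply: le_lt_trans ne; rewrite expr2 ler_piMl//.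
  by rewrite invf_le1 ?ler1n.
have [e e0|l ul] := @ip_complete u.
  have [N hN] := small (e / 4) (divr_gt0 e0 (ltr0n _ 4)).
  exists N => m n Nm Nn.
  have [x [xm xn]] : exists x, ball (u m) (m.+1%:R^-1 : R)%:C x /\
      ball (u n) (n.+1%:R^-1 : R)%:C x.
    exact: filter_ex (filterI (uF m) (uF n)).
  have := lt_trans (near_u _ _ xm) (hN _ Nm).
  have := lt_trans (near_u _ _ xn) (hN _ Nn).
  have := sq2 (u m) x (u n).
  have -> : ip (x - u n) (x - u n) = ip (u n - x) (u n - x).
    by rewrite -opprB ipNl ipNr opprK.
  move: (ip (u m - x) _) (ip (u n - x) _) (ip (u m - u n) _) => a b c.
  by lra.
apply/cvg_ex; exists l; apply/cvgrPdist_lt => /= eps eps0.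
have epsE : eps = (complex.Re eps)%:C.
  by rewrite RRe_real// ger0_real// ltW.
rewrite epsE ltcR in eps0; rewrite epsE; set e := complex.Re eps in eps0 *.
have e2 : 0 < e ^+ 2 / 4 by rewrite divr_gt0 ?exprn_gt0.
have [N hN] := small _ e2; have [N' hN'] := ul _ e2.
have := uF (maxn N N'); apply: filterS => x /near_u xm.
rewrite norm_lt//.
have := lt_trans xm (hN _ (leq_maxl N N')); have := hN' _ (leq_maxr N N').
have := sq2 l (u (maxn N N')) x.
rewrite -(opprB (u _) l) ipNl ipNr opprK.
move: (ip (l - x) _) (ip (u _ - l) _) (ip (u _ - x) _) => a b c.
by lra.
Qed.

HB.instance Definition _ := Uniform_isComplete.Build E cauchy_complete.

Let normdot (x : E) : `|x| ^+ 2 = cdot x x.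
Proof. by rewrite normsq cdot_self. Qed.

HB.instance Definition _ := CompleteNormedModule_isHilbert.Build R E normdot.

HB.end.

(** * The real inner product of a Hilbert space *)

Lemma Re_conj (R : realType) (z : R[i]) : complex.Re (Num.conj z) = complex.Re z.
Proof. by case: z. Qed.

Lemma Re_add (R : realType) (z w : R[i]) :
  complex.Re (z + w) = complex.Re z + complex.Re w.
Proof. by case: z; case: w. Qed.

Lemma Re_realM (R : realType) (c : R) (z : R[i]) :
  complex.Re (c%:C * z) = c * complex.Re z.
Proof. by case: z => a b /=; rewrite mul0r subr0. Qed.

Section RealInnerProduct.
Context {R : realType}.
Implicit Types H K L : hilbertType R.

(** For complex linear operators the real inner product determines the complex
  one, hence isometries and adjoints as well, and its values can be handled by
  real arithmetic. Norms are used through their squares [sqn]. *)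
Definition rdot H (x y : H) : R := complex.Re (hdot x y).
Definition sqn H (x : H) : R := rdot x x.

Section Theory.
Context {H : hilbertType R}.
Implicit Types x y z : H.

Lemma hdotZr (c : R[i]) x y : hdot x (c *: y) = c^* * hdot x y.
Proof. exact: linearZr_LR. Qed.

Lemma hdotZl (c : R[i]) x y : hdot (c *: x) y = c * hdot x y.
Proof. exact: linearZl_LR. Qed.

Lemma rdotC x y : rdot x y = rdot y x.
Proof.
by rewrite /rdot (hermC hdot x y) expr0 mul1r; exact: (Re_conj (hdot y x)).
Qed.

Lemma rdotDl x y z : rdot (x + y) z = rdot x z + rdot y z.
Proof. by rewrite /rdot linearDl; exact: Re_add. Qed.

Lemma rdotDr x y z : rdot x (y + z) = rdot x y + rdot x z.
Proof. by rewrite rdotC rdotDl !(rdotC x). Qed.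

Lemma rdotZl (c : R) x y : rdot (c%:C *: x) y = c * rdot x y.
Proof.
by rewrite /rdot hdotZl; exact: Re_realM.
Qed.

Lemma rdotZr (c : R) x y : rdot x (c%:C *: y) = c * rdot x y.
Proof. by rewrite rdotC rdotZl rdotC. Qed.

Lemma rdotNl x y : rdot (- x) y = - rdot x y.
Proof. by rewrite -scaleN1r -(rmorphN1 (real_complex R)) rdotZl mulN1r. Qed.

Lemma rdotNr x y : rdot x (- y) = - rdot x y.
Proof. by rewrite rdotC rdotNl rdotC. Qed.

Lemma rdotBl x y z : rdot (x - y) z = rdot x z - rdot y z.
Proof. by rewrite rdotDl rdotNl. Qed.

Lemma rdotBr x y z : rdot x (y - z) = rdot x y - rdot x z.
Proof. by rewrite rdotDr rdotNr. Qed.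

Lemma rdot0l y : rdot 0 y = 0.
Proof. by have := rdotDl 0 0 y; rewrite addr0; lra. Qed.

Lemma rdot0r y : rdot y 0 = 0.
Proof. by rewrite rdotC rdot0l. Qed.

Lemma rdotii x y : rdot ('i *: x) ('i *: y) = rdot x y.
Proof.
rewrite /rdot hdotZl hdotZr.
move: (hdot x y) => [a b] /=. ring.
Qed.

Lemma rdot_il x y : rdot ('i *: x) y = - rdot x ('i *: y).
Proof.
rewrite -(rdotii x) scalerA -expr2 sqr_i scaleN1r.
by rewrite rdotNr opprK.
Qed.

Lemma hdot_rdot x y : hdot x y = (rdot x y) +i* (rdot x ('i *: y)).
Proof.
rewrite /rdot hdotZr.
by move: (hdot x y) => [a b] /=; congr (_ +i* _); ring.
Qed.

Lemma hdot_sqn x : hdot x x = (sqn x)%:C.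
Proof.
rewrite hdot_rdot; congr (_ +i* _).
by have := rdot_il x x; rewrite rdotC; lra.
Qed.

Lemma norm_sqn x : `|x| = (Num.sqrt (sqn x))%:C.
Proof.
have h : `|x| = (complex.Re `|x|)%:C by rewrite RRe_real// normr_real.
have hn : 0 <= complex.Re `|x| by rewrite -lecR -h normr_ge0.
have := hdot_norm x; rewrite hdot_sqn h -rmorphXn => /complexI <-.
by rewrite sqrtr_sqr ger0_norm.
Qed.

Lemma sqn_ge0 x : 0 <= sqn x.
Proof. by rewrite -lecR -hdot_sqn -hdot_norm exprn_ge0. Qed.

Lemma sqn_eq0 x : sqn x = 0 -> x = 0.
Proof.
by move=> x0; apply/eqP; rewrite -normr_eq0 norm_sqn x0 sqrtr0.
Qed.

Lemma sqn0 : sqn (0 : H) = 0. Proof. exact: rdot0l. Qed.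

Lemma sqnN x : sqn (- x) = sqn x.
Proof. by rewrite /sqn rdotNl rdotNr opprK. Qed.

Lemma sqn_subC x y : sqn (x - y) = sqn (y - x).
Proof. by rewrite -sqnN opprB. Qed.

Lemma sqnD x y : sqn (x + y) = sqn x + 2 * rdot x y + sqn y.
Proof. by rewrite /sqn rdotDl !rdotDr (rdotC y x); ring. Qed.

Lemma sqnB x y : sqn (x - y) = sqn x - 2 * rdot x y + sqn y.
Proof. by rewrite sqnD sqnN rdotNr; ring. Qed.

Lemma sqnZ (c : R) x : sqn (c%:C *: x) = c ^+ 2 * sqn x.
Proof. by rewrite /sqn rdotZl rdotZr mulrA. Qed.

Lemma sqnD_le x y : sqn (x + y) <= 2 * sqn x + 2 * sqn y.
Proof. by have := sqn_ge0 (x - y); rewrite sqnB sqnD; lra. Qed.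

Lemma sqnB_le x y : sqn (x - y) <= 2 * sqn x + 2 * sqn y.
Proof. by rewrite -(sqnN y) sqnD_le. Qed.

Lemma sqn_dist_le z x y : sqn (x - y) <= 2 * sqn (x - z) + 2 * sqn (z - y).
Proof. by rewrite -(subrK z x) addrK -addrA sqnD_le. Qed.

Lemma sqn_scale (c : R[i]) x :
  sqn (c *: x) = (complex.Re c ^+ 2 + complex.Im c ^+ 2) * sqn x.
Proof.
rewrite scale_complexE sqnD !sqnZ rdotZl rdotZr.
have -> : sqn ('i *: x) = sqn x by rewrite /sqn rdotii.
have -> : rdot x ('i *: x) = 0 by have := rdot_il x x; rewrite rdotC; lra.
by ring.
Qed.

Lemma rdot_cauchy x y : rdot x y ^+ 2 <= sqn x * sqn y.
Proof.
have [y0|y0] := eqVneq (sqn y) 0.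
  by rewrite (sqn_eq0 y0) rdot0r sqn0 expr0n mulr0.
have yp : 0 < sqn y by rewrite lt_neqAle eq_sym y0 sqn_ge0.
have := sqn_ge0 ((sqn y)%:C *: x - (rdot x y)%:C *: y).
rewrite sqnB !sqnZ rdotZl rdotZr => h.
have {h} : 0 <= sqn y * (sqn x * sqn y - rdot x y ^+ 2) by nra.
by rewrite pmulr_rge0// subr_ge0.
Qed.

Lemma rdot_inj x y : (forall z, rdot x z = rdot y z) -> x = y.
Proof.
move=> h; apply/eqP; rewrite -subr_eq0; apply/eqP/sqn_eq0.
by rewrite /sqn [LHS]rdotBl h subrr.
Qed.

Definition sqn_cvg (u : nat -> H) (l : H) : Prop :=
  forall e, 0 < e -> exists N, forall n, (N <= n)%N -> sqn (u n - l) < e.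

Lemma sqn_complete (u : nat -> H) :
  (forall e, 0 < e -> exists N, forall m n, (N <= m)%N -> (N <= n)%N ->
     sqn (u m - u n) < e) -> exists l, sqn_cvg u l.
Proof.
move=> uc.
have norm_lt (x : H) (e : R) : 0 < e -> (`|x| < e%:C) = (sqn x < e ^+ 2).
  move=> e0; rewrite norm_sqn ltcR -[RHS]ltr_sqrt ?exprn_gt0// sqrtr_sqr.
  by rewrite gtr0_norm.
have /cauchy_cvg /cvg_ex[l ul] : cauchy (u @ \oo).
  apply/cauchy_exP => eps eps0.
  have epsE : eps = (complex.Re eps)%:C by rewrite RRe_real// ger0_real// ltW.
  rewrite epsE ltcR in eps0; rewrite epsE.
  have [N hN] := uc _ (exprn_gt0 2 eps0).
  exists (u N); exists N => // n /= Nn.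
  by rewrite -ball_normE /= norm_lt// hN.
exists l => e e0.
have s0 : 0 < Num.sqrt e by rewrite sqrtr_gt0.
move/cvgrPdist_lt : ul => /(_ (Num.sqrt e)%:C).
rewrite ltcR => /(_ s0) [N _ hN].
exists N => n /hN /=.
by rewrite norm_lt// sqr_sqrtr ?ltW// sqn_subC.
Qed.

Lemma sqn_cvg_unique u l l' : sqn_cvg u l -> sqn_cvg u l' -> l = l'.
Proof.
move=> h h'; apply/eqP; rewrite -subr_eq0; apply/eqP/sqn_eq0.
apply/eqP; rewrite eq_le sqn_ge0 andbT leNgt; apply/negP => p.
have e4 : 0 < sqn (l - l') / 4 by lra.
have [N hN] := h _ e4; have [N' hN'] := h' _ e4.
have := hN _ (leq_maxl N N'); have := hN' _ (leq_maxr N N').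
have := sqn_dist_le (u (maxn N N')) l l'.
by rewrite (sqn_subC l (u _)); lra.
Qed.

Lemma sqn_cvgD u v l m :
  sqn_cvg u l -> sqn_cvg v m -> sqn_cvg (fun n => u n + v n) (l + m).
Proof.
move=> ul vm e e0; have e4 : 0 < e / 4 by lra.
have [N hN] := ul _ e4; have [N' hN'] := vm _ e4.
exists (maxn N N') => n; rewrite geq_max => /andP[/hN h /hN' h'].
rewrite opprD addrACA; apply: le_lt_trans (sqnD_le _ _) _; lra.
Qed.

Lemma sqn_cvgZ c u l : sqn_cvg u l -> sqn_cvg (fun n => c *: u n) (c *: l).
Proof.
move=> ul e e0.
set M := complex.Re c ^+ 2 + complex.Im c ^+ 2 + 1.
have Mp : 0 < M by rewrite ltr_wpDl ?addr_ge0 ?sqr_ge0.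
have [N hN] := ul _ (divr_gt0 e0 Mp).
exists N => n /hN; rewrite ltr_pdivlMr// => h.
rewrite -scalerBr sqn_scale; apply: le_lt_trans h.
by rewrite mulrC ler_wpM2l ?sqn_ge0// /M lerDl ler01.
Qed.

End Theory.

(** * Bounded operators *)

Lemma op_bound H K (T : bounded_op H K) :
  exists2 M : R, 0 <= M & forall x, sqn (T x) <= M * sqn x.
Proof.
have [M hM] := bounded_opP T.
exists (M ^+ 2); first exact: sqr_ge0.
move=> x; have := hM x; rewrite !norm_sqn -rmorphM lecR => h.
rewrite -[sqn (T x)]sqr_sqrtr ?sqn_ge0// -[sqn x]sqr_sqrtr ?sqn_ge0//.
by rewrite -exprMn lerXn2r ?nnegrE ?sqrtr_ge0//; apply: le_trans h; apply: sqrtr_ge0.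
Qed.

Lemma sqn_bounded H K (f : H -> K) :
  (exists M : R, forall x, sqn (f x) <= M * sqn x) ->
  exists M : R, forall x, `|f x| <= M%:C * `|x|.
Proof.
move=> [M hM]; exists (Num.sqrt (Num.max 0 M)) => x.
rewrite !norm_sqn -rmorphM lecR -sqrtrM ?le_max ?lexx//.
apply: ler_wsqrtr; apply: le_trans (hM x) _.
by rewrite ler_wpM2r ?sqn_ge0// le_max lexx orbT.
Qed.

Definition mk_linear (U V : lmodType R[i]) (f : U -> V) (lf : linear f) :
  {linear U -> V} := HB.pack f (GRing.isLinear.Build _ _ _ _ f lf).

Definition mkop H K (f : H -> K) (lf : linear f)
    (bf : exists M : R, forall x, sqn (f x) <= M * sqn x) : bounded_op H K :=
  @BoundedOp R H K (mk_linear lf) (sqn_bounded bf).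

Lemma opnorm_le H K (T : bounded_op H K) x : sqn (T x) <= opnorm T ^+ 2 * sqn x.
Proof.
have [x0|x0] := eqVneq (sqn x) 0.
  by rewrite (sqn_eq0 x0) linear0 !sqn0 mulr0.
have xp : 0 < sqn x by rewrite lt_neqAle eq_sym x0 sqn_ge0.
have sp : 0 < Num.sqrt (sqn x) by rewrite sqrtr_gt0.
have [M M0 hM] := op_bound T.
pose y := ((Num.sqrt (sqn x))^-1)%:C *: x.
have ysq : sqn y = 1.
  by rewrite sqnZ exprVn sqr_sqrtr ?sqn_ge0// mulVf.
have : complex.Re `|T y| <= opnorm T.
  apply: ub_le_sup; last by exists y => //=; rewrite norm_sqn ysq sqrtr1.
  exists (Num.sqrt M) => _ [z /= z1 <-].
  rewrite norm_sqn /=; apply: ler_wsqrtr; apply: le_trans (hM z) _.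
  rewrite -[leRHS]mulr1 ler_wpM2l//.
  move: z1; rewrite norm_sqn lecR => z1.
  by rewrite -(sqr_sqrtr (sqn_ge0 z)) expr_le1 ?sqrtr_ge0.
rewrite norm_sqn /= => h.
have {h} : sqn (T y) <= opnorm T ^+ 2.
  rewrite -(sqr_sqrtr (sqn_ge0 (T y))) lerXn2r ?nnegrE ?sqrtr_ge0//.
  by apply: le_trans h; apply: sqrtr_ge0.
by rewrite linearZ sqnZ exprVn sqr_sqrtr ?sqn_ge0// mulrC ler_pdivrMr.
Qed.

Lemma opnorm_ge0 H K (T : bounded_op H K) : 0 <= opnorm T.
Proof.
rewrite leNgt; apply/negP => neg.
have [M M0 hM] := op_bound T.
have : complex.Re `|T 0| <= opnorm T.
  apply: ub_le_sup; last by exists 0 => //=; rewrite normr0.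
  exists (Num.sqrt M) => _ [z /= z1 <-].
  rewrite norm_sqn /=; apply: ler_wsqrtr; apply: le_trans (hM z) _.
  rewrite -[leRHS]mulr1 ler_wpM2l//.
  move: z1; rewrite norm_sqn lecR => z1.
  by rewrite -(sqr_sqrtr (sqn_ge0 z)) expr_le1 ?sqrtr_ge0.
by rewrite linear0 normr0 /= leNgt neg.
Qed.

End RealInnerProduct.

Section OperatorAlgebra.
Context {R : realType}.
Implicit Types H K L : hilbertType R.

Lemma linear_idfun H : linear (@idfun H).
Proof. by []. Qed.

Lemma bounded_idfun H : exists M : R, forall x : H, sqn (idfun x) <= M * sqn x.
Proof. by exists 1 => x; rewrite mul1r. Qed.

Definition idop H : 'B(H) := mkop (@linear_idfun H) (@bounded_idfun H).

Definition zeroop H K : bounded_op H K.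
Proof.
by apply: (@mkop _ H K (fun=> 0)) => [c x y|]; [rewrite scaler0 addr0 |
  exists 0 => x; rewrite mul0r sqn0].
Defined.

Section Comp.
Context {H K L : hilbertType R} (S : bounded_op K L) (T : bounded_op H K).

Lemma linear_comp : linear (fun x => S (T x)).
Proof. by move=> c x y; rewrite !linearP. Qed.

Lemma bounded_comp : exists M : R, forall x, sqn (S (T x)) <= M * sqn x.
Proof.
have [M M0 hM] := op_bound S; have [N N0 hN] := op_bound T.
exists (M * N) => x; apply: le_trans (hM _) _.
by rewrite -mulrA ler_wpM2l.
Qed.

Definition compop : bounded_op H L := mkop linear_comp bounded_comp.
End Comp.

Section Add.
Context {H K : hilbertType R} (S T : bounded_op H K).

Lemma linear_add : linear (fun x => S x + T x).
Proof. by move=> c x y; rewrite !linearP scalerDr addrACA. Qed.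

Lemma bounded_add : exists M : R, forall x, sqn (S x + T x) <= M * sqn x.
Proof.
have [M M0 hM] := op_bound S; have [N N0 hN] := op_bound T.
exists (2 * M + 2 * N) => x; apply: le_trans (sqnD_le _ _) _.
by have := hM x; have := hN x; lra.
Qed.

Definition addop : bounded_op H K := mkop linear_add bounded_add.

Lemma linear_sub : linear (fun x => S x - T x).
Proof. by move=> c x y; rewrite (linearP S) (linearP T) scalerBr opprD addrACA. Qed.

Lemma bounded_sub : exists M : R, forall x, sqn (S x - T x) <= M * sqn x.
Proof.
have [M M0 hM] := op_bound S; have [N N0 hN] := op_bound T.
exists (2 * M + 2 * N) => x; apply: le_trans (sqnB_le _ _) _.
by have := hM x; have := hN x; lra.
Qed.

Definition subop : bounded_op H K := mkop linear_sub bounded_sub.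

Lemma linear_half : linear (fun x => (2^-1 : R)%:C *: S x).
Proof.
by move=> c x y; rewrite linearP scalerDr !scalerA mulrC.
Qed.

Lemma bounded_half : exists M : R, forall x, sqn ((2^-1 : R)%:C *: S x) <= M * sqn x.
Proof.
have [M M0 hM] := op_bound S; exists (2^-1 ^+ 2 * M) => x.
by rewrite sqnZ -[leRHS]mulrA; apply: ler_wpM2l (hM x); exact: sqr_ge0.
Qed.

Definition halfop : bounded_op H K := mkop linear_half bounded_half.
End Add.

(** * Riesz's theorem and adjoints *)

Lemma rdot_scaler H (c : R[i]) (x y : H) : rdot x (c *: y) = rdot (c^* *: x) y.
Proof.
rewrite scale_complexE rdotDr !rdotZr [c^* *: x]scale_complexE rdotDl !rdotZl.
by rewrite rdot_il; case: c => a b /=; ring.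
Qed.

Lemma sqn_cvg_rdot H (u : nat -> H) l v : sqn_cvg u l ->
  forall e, 0 < e -> exists N, forall n, (N <= n)%N ->
    `|rdot (u n) v - rdot l v| < e.
Proof.
move=> ul e e0.
have s1 : 0 < sqn v + 1 by rewrite ltr_wpDl ?sqn_ge0.
have [N hN] := ul _ (divr_gt0 (exprn_gt0 2 e0) s1).
exists N => n /hN; rewrite ltr_pdivlMr// -rdotBl => h.
rewrite -ltr_sqr ?nnegrE ?(ltW e0)// real_normK ?num_real//.
apply: le_lt_trans (rdot_cauchy _ _) _.
by apply: le_lt_trans h; rewrite ler_wpM2l ?sqn_ge0// lerDl ler01.
Qed.

(** The vector representing [f] is the minimiser of [sqn x - 2 * f x]; a
  minimising sequence is Cauchy by the parallelogram law. *)
Lemma riesz H (f : H -> R) (C : R) : 0 <= C ->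
  (forall x y, f (x + y) = f x + f y) ->
  (forall (c : R) x, f (c%:C *: x) = c * f x) ->
  (forall x, f x ^+ 2 <= C * sqn x) ->
  exists z, forall x, f x = rdot x z.
Proof.
move=> C0 fD fZ fb.
pose J x := sqn x - 2 * f x.
have DJ x : - (C + 1) <= J x.
  have := fb x; rewrite /J; have := sqn_ge0 x.
  move: (sqn x) (f x) => s t s0 ts.
  have : (2 * t) ^+ 2 <= (s + (C + 1)) ^+ 2.
    by have := sqr_ge0 (s - (C + 1)); rewrite !expr2 in ts *; nra.
  have sC : 0 <= s + (C + 1) by lra.
  have [t0|t0] := lerP 0 (2 * t); last by move=> _; lra.
  by rewrite ler_sqr ?nnegrE//; lra.
pose m := inf (range J).
have Jlb : has_inf (range J).
  by split; [exists (J 0); exists 0 | exists (- (C + 1)) => _ [x _ <-]].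
have mJ x : m <= J x by apply: ge_inf; [case: Jlb | exists x].
have pos n : 0 < (n.+1%:R^-1 : R) by rewrite invr_gt0.
have /choice[u uJ] : forall n, exists x, J x < m + n.+1%:R^-1.
  by move=> n; have [_ [x _ <-] h] := inf_adherent (pos n) Jlb; exists x.
have small e : 0 < e -> exists N, forall n, (N <= n)%N -> n.+1%:R^-1 < e :> R.
  move=> e0; exists (Num.truncn e^-1) => n Nn.
  have n1 : e^-1 < n.+1%:R.
    by rewrite (lt_le_trans (truncnS_gt _))// ler_nat ltnS.
  by rewrite invf_plt ?posrE.
(* the parallelogram law, with the midpoint of [x] and [y] *)
have para x y : sqn (x - y) <= 2 * (J x - m) + 2 * (J y - m).
  have := mJ ((2^-1 : R)%:C *: (x + y)).
  have E : (2^-1 : R) ^+ 2 = 1 / 4 by field.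
  rewrite /J sqnZ E fZ fD sqnB sqnD [2 * (_ * _)]mulrA mulfV ?pnatr_eq0// mul1r.
  by lra.
have [e e0|z uz] := @sqn_complete R H u.
  have [N hN] := small (e / 4) (divr_gt0 e0 (ltr0n _ 4)).
  exists N => i j /hN hi /hN hj; have := para (u i) (u j).
  have := uJ i; have := uJ j; move: hi hj.
  by move: (i.+1%:R^-1) (j.+1%:R^-1) => a b; lra.
exists z => v; apply/eqP; apply: contraT => ne.
set g := rdot v z - f v.
have g2 : 0 < g ^+ 2 by rewrite exprn_even_gt0//= subr_eq0 eq_sym.
have s1 : 0 < sqn v + 1 by rewrite ltr_wpDl ?sqn_ge0.
(* moving from [z] by [t v] would lower the minimum by at least [e] *)
pose t := - g / (sqn v + 1); pose e := g ^+ 2 / (sqn v + 1).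
have e0 : 0 < e by rewrite divr_gt0.
have tE : 2 * t * g + t ^+ 2 * sqn v <= - e.
  have -> : 2 * t * g + t ^+ 2 * sqn v = - e - g ^+ 2 / (sqn v + 1) ^+ 2.
    by rewrite /t /e; field; rewrite gt_eqF.
  by rewrite lerBlDr lerDl ltW// divr_gt0// exprn_gt0.
have b0 : 0 < 2 * `|t| + 1 by rewrite ltr_wpDl// mulr_ge0.
have e2 : 0 < e / 2 by lra.
have [N hN] := small _ e2.
have [N' hN'] := sqn_cvg_rdot v uz (divr_gt0 e2 b0).
have := hN _ (leq_maxl N N'); have := hN' _ (leq_maxr N N').
set n := maxn N N' => dn hn.
have := mJ (u n + t%:C *: v); have := uJ n.
rewrite /J sqnD sqnZ rdotZr fD fZ => h1 h2.
have : 2 * t * (rdot (u n) v - f v) + t ^+ 2 * sqn v > - n.+1%:R^-1.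
  by move: h1 h2; move: (n.+1%:R^-1) => a; lra.
have -> : rdot (u n) v - f v = g + (rdot (u n) v - rdot z v).
  by rewrite /g (rdotC v z); ring.
have : 2 * t * (rdot (u n) v - rdot z v) <= e / 2.
  apply: le_trans (ler_norm _) _; rewrite normrM (normrM 2) (@ger0_norm _ 2)//.
  move: dn; rewrite ltr_pdivlMr// => dn; apply: le_trans (ltW dn).
  by rewrite [leRHS]mulrC ler_wpM2r// lerDl ler01.
by move=> h3; rewrite mulrDr; move: hn; move: (n.+1%:R^-1) => a; lra.
Qed.

Section Adjoint.
Context {H K : hilbertType R} (T : bounded_op H K).

Lemma adjoint_linear (S : K -> H) :
  (forall x y, rdot (T x) y = rdot x (S y)) -> linear S.
Proof.
move=> TS c x y; apply: rdot_inj => z; rewrite ![rdot _ z]rdotC.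
rewrite -TS !rdotDr -TS; congr (_ + _).
by rewrite !rdot_scaler -TS linearZ.
Qed.

(** The bound comes from [sqn (S y) = rdot (T (S y)) y]. *)
Lemma adjoint_sqn_le (S : K -> H) (M : R) : 0 <= M ->
  (forall x y, rdot (T x) y = rdot x (S y)) ->
  (forall x, sqn (T x) <= M * sqn x) -> forall y, sqn (S y) <= M * sqn y.
Proof.
move=> M0 TS hM y; have := rdot_cauchy (T (S y)) y; rewrite TS -/(sqn _).
have := hM (S y); have := sqn_ge0 (S y); have := sqn_ge0 y.
move: (sqn (T _)) (sqn (S y)) (sqn y) => a b c c0 b0 ab bc.
have [b00|bn] := eqVneq b 0; first by rewrite b00 mulr_ge0.
have bp : 0 < b by rewrite lt_neqAle eq_sym bn.
have : b * b <= b * (M * c) by nra.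
by rewrite ler_pM2l.
Qed.

Lemma adjoint_ex : exists S : K -> H, forall x y, rdot (T x) y = rdot x (S y).
Proof.
have /choice[S hS] : forall y, exists z, forall x, rdot (T x) y = rdot x z.
  move=> y; have [M M0 hM] := op_bound T.
  apply: (@riesz _ (fun x => rdot (T x) y) (M * sqn y)).
  - by rewrite mulr_ge0 ?sqn_ge0.
  - by move=> a b; rewrite linearD rdotDl.
  - by move=> c a; rewrite linearZ rdotZl.
  - move=> a; apply: le_trans (rdot_cauchy _ _) _.
    by rewrite mulrAC ler_wpM2r ?sqn_ge0.
by exists S.
Qed.

Lemma adj_ex : exists S : bounded_op K H,
  forall x y, rdot (T x) y = rdot x (S y).
Proof.
have [S SP] := adjoint_ex.
have Sb : exists M : R, forall y, sqn (S y) <= M * sqn y.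
  by have [M M0 hM] := op_bound T; exists M; apply: adjoint_sqn_le.
by exists (mkop (adjoint_linear SP) Sb).
Qed.

Definition adj : bounded_op K H := sval (cid adj_ex).

Lemma adjP x y : rdot (T x) y = rdot x (adj y).
Proof. exact: (svalP (cid adj_ex)). Qed.

Lemma adjPl x y : rdot (adj x) y = rdot x (T y).
Proof. by rewrite rdotC -adjP rdotC. Qed.

Lemma adj_unique (S' : K -> H) :
  (forall x y, rdot (T x) y = rdot x (S' y)) -> S' =1 adj.
Proof.
by move=> h y; apply: rdot_inj => z; rewrite rdotC -h rdotC adjPl rdotC.
Qed.
End Adjoint.

Lemma rdot_adjoint H (T S : 'B(H)) :
  (forall x y, rdot (T x) y = rdot x (S y)) -> is_adjoint T S.
Proof.
move=> h x y; rewrite !hdot_rdot h; congr (_ +i* _).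
by rewrite h linearZ.
Qed.

Lemma adj_is_adjoint H (T : 'B(H)) : is_adjoint T (adj T).
Proof. by apply: rdot_adjoint; apply: adjP. Qed.

End OperatorAlgebra.

(** * Orthogonal sums and square-summable sequences *)

(** A copy of the product type, which does not inherit its maximum norm. *)
Definition hsum (R : realType) (K L : hilbertType R) : Type := (K * L)%type.

Section Hsum.
Context {R : realType} (K L : hilbertType R).
Let E := hsum K L.

HB.instance Definition _ := GRing.Lmodule.copy (hsum K L) (K * L)%type.

Let ip (x y : E) : R := rdot x.1 y.1 + rdot x.2 y.2.

Let ipC x y : ip x y = ip y x.
Proof. by rewrite /ip (rdotC x.1) (rdotC x.2). Qed.

Let ipDl x y z : ip (x + y) z = ip x z + ip y z.
Proof. by rewrite /ip !rdotDl addrACA. Qed.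

Let ipZl (c : R) x y : ip (c%:C *: x) y = c * ip x y.
Proof. by rewrite /ip !rdotZl mulrDr. Qed.

Let ipi x y : ip ('i *: x) ('i *: y) = ip x y.
Proof. by rewrite /ip !rdotii. Qed.

Let ip_gt0 x : x != 0 -> 0 < ip x x.
Proof.
move=> x0; rewrite lt_neqAle addr_ge0 ?sqn_ge0// andbT eq_sym.
apply: contra x0; rewrite paddr_eq0 ?sqn_ge0// => /andP[/eqP h1 /eqP h2].
by apply/eqP; apply: injective_projections; apply: sqn_eq0.
Qed.

Let ip_complete (u : nat -> E) :
  (forall e, 0 < e -> exists N, forall m n, (N <= m)%N -> (N <= n)%N ->
     ip (u m - u n) (u m - u n) < e) ->
  exists l, forall e, 0 < e -> exists N, forall n, (N <= n)%N ->
     ip (u n - l) (u n - l) < e.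
Proof.
move=> uc.
have [l1 ul1] : exists l, sqn_cvg (fun n => (u n).1) l.
  apply: sqn_complete => e /uc[N hN]; exists N => m n Nm Nn.
  apply: le_lt_trans (hN m n Nm Nn).
  by rewrite /ip lerDl sqn_ge0.
have [l2 ul2] : exists l, sqn_cvg (fun n => (u n).2) l.
  apply: sqn_complete => e /uc[N hN]; exists N => m n Nm Nn.
  apply: le_lt_trans (hN m n Nm Nn).
  by rewrite /ip lerDr sqn_ge0.
exists (l1, l2) => e e0; have e2 : 0 < e / 2 by lra.
have [N hN] := ul1 _ e2; have [N' hN'] := ul2 _ e2.
exists (maxn N N') => n; rewrite geq_max => /andP[/hN h /hN' h'].
by move: h h'; rewrite /ip /sqn; lra.
Qed.

HB.instance Definition _ :=
  @Lmodule_isHilbert.Build R (hsum K L) ip ipC ipDl ipZl ipi ip_gt0 ip_complete.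

End Hsum.

Section HsumTheory.
Context {R : realType} {K L : hilbertType R}.

Lemma rdot_hsum (x y : hsum K L) : rdot x y = rdot x.1 y.1 + rdot x.2 y.2.
Proof. by []. Qed.

Lemma sqn_hsum (x : hsum K L) : sqn x = sqn x.1 + sqn x.2.
Proof. by []. Qed.

Lemma hsumP (x y : hsum K L) : x.1 = y.1 -> x.2 = y.2 -> x = y.
Proof. exact: injective_projections. Qed.

End HsumTheory.

Section L2.
Context {R : realType} (H : hilbertType R).

Definition sqsummable (x : nat -> H) : Prop :=
  exists C : R, forall N, \sum_(n < N) sqn (x n) <= C.

Definition l2_pred : {pred (nat -> H)} := [pred x | `[< sqsummable x >]].

Lemma sqsummableD x y : sqsummable x -> sqsummable y -> sqsummable (x + y).
Proof.
move=> [C hC] [D hD]; exists (2 * C + 2 * D) => N.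
apply: (@le_trans _ _ (\sum_(n < N) (2 * sqn (x n) + 2 * sqn (y n)))).
  by apply: ler_sum => i _; apply: sqnD_le.
by rewrite big_split/= -!mulr_sumr; have := hC N; have := hD N; lra.
Qed.

Lemma sqsummableZ c x : sqsummable x -> sqsummable (c *: x).
Proof.
move=> [C hC]; exists ((complex.Re c ^+ 2 + complex.Im c ^+ 2) * C) => N.
under eq_bigr do rewrite sqn_scale.
by rewrite -mulr_sumr ler_wpM2l// addr_ge0 ?sqr_ge0.
Qed.

Lemma sqsummable0 : sqsummable 0.
Proof. by exists 0 => N; rewrite big1// => i _; rewrite sqn0. Qed.

Lemma l2_submod_closed : submod_closed l2_pred.
Proof.
split; first by apply/asboolP; exact: sqsummable0.
move=> c x y /asboolP xs /asboolP ys; apply/asboolP.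
by apply: sqsummableD => //; apply: sqsummableZ.
Qed.

HB.instance Definition _ :=
  GRing.isSubmodClosed.Build R[i] (nat -> H) l2_pred l2_submod_closed.

Record l2 := L2Seq { l2val :> nat -> H; l2_valP : l2val \in l2_pred }.
HB.instance Definition _ := [isSub for l2val].
HB.instance Definition _ := [Choice of l2 by <:].
HB.instance Definition _ := [SubChoice_isSubLmodule of l2 by <:].

Lemma l2_ext (x y : l2) : (forall n, x n = y n) -> x = y.
Proof. by move=> h; apply: val_inj; apply/funext. Qed.

Lemma l2P (x : l2) : sqsummable x.
Proof. by apply/asboolP; exact: l2_valP. Qed.

Definition mkl2 (x : nat -> H) (hx : sqsummable x) : l2 := L2Seq (asboolT hx).

Let E := l2.
Let f (x y : E) n : R := rdot (x n) (y n).

Let sum_cvg (x y : E) : cvgn (series (f x y)).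
Proof.
apply: normed_cvg.
have [C hC] := l2P x; have [D hD] := l2P y.
apply: (@series_le_cvg R _ (fun n => sqn (x n) + sqn (y n))).
- by move=> n; apply: normr_ge0.
- by move=> n; rewrite addr_ge0 ?sqn_ge0.
- move=> n /=; rewrite ler_norml /f; have := sqn_ge0 (x n + y n).
  by have := sqn_ge0 (x n - y n); rewrite sqnB sqnD; lra.
apply: nondecreasing_is_cvgn.
  by apply: nondecreasing_series => n _ _; rewrite addr_ge0 ?sqn_ge0.
exists (C + D) => _ [N _ <-]; rewrite /series/= big_mkord big_split/=.
by apply: lerD; [exact: hC | exact: hD].
Qed.

Let ip (x y : E) : R := limn (series (f x y)).

Let eq_ip x y x' y' : (forall n, f x y n = f x' y' n) -> ip x y = ip x' y'.
Proof. by move=> h; rewrite /ip; congr (limn (series _)); apply/funext. Qed.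

Let ipC x y : ip x y = ip y x.
Proof. by apply: eq_ip => n; exact: rdotC. Qed.

Let ipDl x y z : ip (x + y) z = ip x z + ip y z.
Proof.
rewrite /ip -lim_seriesD//; congr (limn (series _)).
by apply/funext => n; exact: rdotDl.
Qed.

Let ipZl (c : R) x y : ip (c%:C *: x) y = c * ip x y.
Proof.
rewrite /ip -[RHS]/(c *: limn (series (f x y))) -lim_seriesZ//.
congr (limn (series _)).
by apply/funext => n; exact: rdotZl.
Qed.

Let ipi x y : ip ('i *: x) ('i *: y) = ip x y.
Proof. by apply: eq_ip => n; exact: rdotii. Qed.

Let ip_partial (x : E) N : \sum_(n < N) sqn (x n) <= ip x x.
Proof.
have -> : \sum_(n < N) sqn (x n) = series (f x x) N by rewrite /series/= big_mkord.
apply: nondecreasing_cvgn_le => //.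
by apply: nondecreasing_series => n _ _; apply: sqn_ge0.
Qed.

Let ip_le (x : E) C : (forall N, \sum_(n < N) sqn (x n) <= C) -> ip x x <= C.
Proof.
move=> h; apply: limr_le => //; apply: nearW => N.
by rewrite /series/= big_mkord.
Qed.

Let ip_gt0 (x : E) : x != 0 -> 0 < ip x x.
Proof.
move=> x0; rewrite ltNge; apply: contra x0 => h.
apply/eqP/l2_ext => n; apply: sqn_eq0; apply/eqP.
rewrite eq_le sqn_ge0 andbT.
apply: le_trans h; apply: le_trans (ip_partial x n.+1).
by rewrite big_ord_recr /= lerDr sumr_ge0// => i _; apply: sqn_ge0.
Qed.

Let ip_complete (u : nat -> E) :
  (forall e, 0 < e -> exists N, forall m n, (N <= m)%N -> (N <= n)%N ->
     ip (u m - u n) (u m - u n) < e) ->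
  exists l, forall e, 0 < e -> exists N, forall n, (N <= n)%N ->
     ip (u n - l) (u n - l) < e.
Proof.
move=> uc.
have /choice[l ul] : forall k, exists l, sqn_cvg (fun n => u n k) l.
  move=> k; apply: sqn_complete => e /uc[N hN]; exists N => m n Nm Nn.
  apply: le_lt_trans (hN m n Nm Nn); apply: le_trans (ip_partial _ k.+1).
  by rewrite big_ord_recr /= lerDr sumr_ge0// => i _; apply: sqn_ge0.
have ulN N e : 0 < e -> exists M, forall n, (M <= n)%N ->
    \sum_(k < N) sqn (u n k - l k) < e.
  elim: N e => [|N IH] e e0; first by exists 0%N => n _; rewrite big_ord0.
  have e2 : 0 < e / 2 by lra.
  have [M hM] := IH _ e2; have [M' hM'] := ul N _ e2.
  exists (maxn M M') => n; rewrite geq_max => /andP[/hM h /hM' h'].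
  by rewrite big_ord_recr /=; lra.
(* uniformly in the number [N] of coordinates, by comparison with a late term *)
have tail e : 0 < e -> exists M, forall n N, (M <= n)%N ->
    \sum_(k < N) sqn (u n k - l k) <= e.
  move=> e0; have e4 : 0 < e / 4 by lra.
  have [M hM] := uc _ e4; exists M => n N Mn.
  have [M' hM'] := ulN N _ e4.
  set m := maxn M M'.
  apply: (@le_trans _ _ (\sum_(k < N)
      (2 * sqn ((u n - u m) k) + 2 * sqn (u m k - l k)))).
    by apply: ler_sum => k _; apply: sqn_dist_le.
  rewrite big_split /= -!mulr_sumr.
  have := hM' m (leq_maxr _ _); have := hM n m Mn (leq_maxl _ _).
  by have := ip_partial (u n - u m) N; lra.
have ls : sqsummable l.
  have [M hM] := tail 1 ltr01; have [C hC] := l2P (u M).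
  exists (2 * C + 2) => N.
  apply: (@le_trans _ _ (\sum_(k < N)
      (2 * sqn (u M k) + 2 * sqn (u M k - l k)))).
    apply: ler_sum => k _; rewrite -[l k](subKr (u M k)).
    by rewrite [in leRHS]subKr sqnB_le.
  rewrite big_split /= -!mulr_sumr.
  by have := hC N; have := hM M N (leqnn _); lra.
exists (mkl2 ls) => e e0; have e2 : 0 < e / 2 by lra.
have [M hM] := tail _ e2; exists M => n Mn.
apply: (@le_lt_trans _ _ (e / 2)); last by lra.
by apply: ip_le => N; apply: hM.
Qed.

HB.instance Definition _ :=
  @Lmodule_isHilbert.Build R l2 ip ipC ipDl ipZl ipi ip_gt0 ip_complete.

Lemma l2_rdot_cvg (x y : l2) :
  (fun N => \sum_(n < N) rdot (x n) (y n)) @ \oo --> rdot x y.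
Proof.
have -> : (fun N => \sum_(n < N) rdot (x n) (y n)) = series (f x y).
  by apply/funext => N; rewrite /series /= big_mkord.
exact: sum_cvg.
Qed.

Lemma l2_partial (x : l2) N : \sum_(n < N) sqn (x n) <= sqn x.
Proof. exact: ip_partial. Qed.

Lemma l2_sqn_le (x : l2) C :
  (forall N, \sum_(n < N) sqn (x n) <= C) -> sqn x <= C.
Proof. exact: ip_le. Qed.

End L2.

(** * Square roots and inverses of operators *)

Section Norm.
Context {R : realType} {H : hilbertType R}.
Implicit Types x y : H.

Definition nrm x : R := Num.sqrt (sqn x).

Lemma nrm_ge0 x : 0 <= nrm x. Proof. exact: sqrtr_ge0. Qed.

Lemma nrm_sqr x : nrm x ^+ 2 = sqn x.
Proof. by rewrite sqr_sqrtr ?sqn_ge0. Qed.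

Lemma nrm0 : nrm (0 : H) = 0. Proof. by rewrite /nrm sqn0 sqrtr0. Qed.

Lemma nrmD x y : nrm (x + y) <= nrm x + nrm y.
Proof.
have [h|h] := lerP (nrm (x + y)) (nrm x + nrm y) => //.
have := rdot_cauchy x y; have := sqnD x y; rewrite -!nrm_sqr.
have := nrm_ge0 x; have := nrm_ge0 y; move: h.
move: (nrm x) (nrm y) (nrm (x + y)) (rdot x y) => a b c d h b0 a0 e1 e2.
have : d <= a * b.
  have ab : 0 <= a * b by rewrite mulr_ge0.
  have [d0|d0] := lerP 0 d; last by lra.
  by rewrite -ler_sqr ?nnegrE// exprMn.
by rewrite !expr2 in e1; nra.
Qed.

Lemma nrmZ (c : R) x : 0 <= c -> nrm (c%:C *: x) = c * nrm x.
Proof. by move=> c0; rewrite /nrm sqnZ sqrtrM ?sqr_ge0// sqrtr_sqr ger0_norm. Qed.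

Lemma nrm_le_sqn c x : 0 <= c -> (nrm x <= c) = (sqn x <= c ^+ 2).
Proof. by move=> c0; rewrite -nrm_sqr ler_sqr ?nnegrE ?nrm_ge0. Qed.

Lemma sqn_cvg_nrm_le u (l : H) (c : R) :
  sqn_cvg u l -> (forall n, nrm (u n) <= c) -> nrm l <= c.
Proof.
move=> ul uc; apply/ler_addgt0Pr => e e0.
have [N hN] := ul _ (exprn_gt0 2 e0).
have := hN N (leqnn _); rewrite sqn_subC => h.
have h' : nrm (l - u N) <= e by rewrite nrm_le_sqn ?ltW.
by have := nrmD (l - u N) (u N); rewrite subrK; have := uc N; lra.
Qed.

End Norm.

Section OperatorLimits.
Context {R : realType}.
Implicit Types H K : hilbertType R.

(** Completeness of the space of operators in the form used below: the
  increments of [Y] are dominated by those of a bounded monotone real sequence,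
  which is Cauchy. *)
Lemma op_limit H (Y : nat -> 'B(H)) (y : nat -> R) (M : R) :
  (forall n, y n <= y n.+1) -> (forall n, y n <= M) ->
  (forall n x, nrm (Y n x) <= y n * nrm x) ->
  (forall n x, nrm (Y n.+1 x - Y n x) <= (y n.+1 - y n) * nrm x) ->
  exists2 L : 'B(H), forall x, sqn_cvg (fun n => Y n x) (L x) &
    forall x, nrm (L x) <= M * nrm x.
Proof.
move=> yS yM Yy Yd.
have ynd : nondecreasing_seq y by apply/nondecreasing_seqP.
have ycv : cvgn y.
  by apply: nondecreasing_is_cvgn => //; exists M => _ [n _ <-].
have Ymn x n k : nrm (Y (n + k)%N x - Y n x) <= (y (n + k)%N - y n) * nrm x.
  elim: k => [|k IH]; first by rewrite addn0 !subrr nrm0 mul0r.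
  rewrite -(subrK (Y (n + k)%N x) (Y (n + k.+1)%N x)) -addrA addnS.
  apply: le_trans (nrmD _ _) _.
  by have := Yd (n + k)%N x; move: IH; lra.
have Yc x : exists l, sqn_cvg (fun n => Y n x) l.
  apply: sqn_complete => e e0.
  have s0 : 0 < Num.sqrt e by rewrite sqrtr_gt0.
  have d0 : 0 < Num.sqrt e / (nrm x + 1).
    by rewrite divr_gt0// ltr_wpDl ?nrm_ge0.
  move/cvgrPdist_lt : (ycv) => /(_ _ d0) [N _ hN].
  have key i j : (N <= i)%N -> (i <= j)%N -> sqn (Y j x - Y i x) < e.
    move=> Ni ij; have := hN i Ni => /=.
    have yl k : y k <= limn y by apply: nondecreasing_cvgn_le.
    rewrite ger0_norm ?subr_ge0// ltr_pdivlMr ?ltr_wpDl ?nrm_ge0// => h.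
    rewrite -(sqr_sqrtr (ltW e0)) -nrm_sqr ltr_sqr ?nnegrE ?nrm_ge0 ?(ltW s0)//.
    have := Ymn x i (j - i)%N; rewrite subnKC//.
    by have := yl j; have := yl i; have := nrm_ge0 x; nra.
  exists N => m n Nm Nn; have [mn|/ltnW nm] := leqP m n.
    by rewrite sqn_subC; apply: key.
  exact: key.
have /choice[L LY] := Yc.
have Llin : linear L.
  move=> c x z; apply: sqn_cvg_unique (LY _) _.
  have := sqn_cvgD (sqn_cvgZ c (LY x)) (LY z).
  by congr sqn_cvg; apply/funext => n; rewrite linearP.
have M0 : 0 <= M \/ forall x : H, nrm x = 0.
  have [|Mneg] := lerP 0 M; [by left | right=> x].
  apply/eqP; rewrite eq_le nrm_ge0 andbT leNgt; apply/negP => x0.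
  have := Yy 0%N x; have := yM 0%N; have := nrm_ge0 (Y 0%N x); nra.
have Lb x : nrm (L x) <= M * nrm x.
  apply: sqn_cvg_nrm_le (LY x) _ => n; apply: le_trans (Yy _ _) _.
  by rewrite ler_wpM2r ?nrm_ge0.
have Lbd : exists M : R, forall x, sqn (L x) <= M * sqn x.
  exists (M ^+ 2) => x; rewrite -!nrm_sqr -exprMn.
  by rewrite lerXn2r ?nnegrE ?nrm_ge0//; apply: le_trans (Lb x); apply: nrm_ge0.
by exists (mkop Llin Lbd).
Qed.

(** The square root of [1 - A] is [1 - L], where [L] is the limit of the
  iteration [Y' = (A + Y ^ 2) / 2] started at [0]. The same iteration for real
  numbers, with [A] replaced by [1], is increasing and bounded by [1], and its
  increments dominate those of the operators. *)
Lemma op_sqrt_ex H (A : 'B(H)) : (forall x, sqn (A x) <= sqn x) ->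
  (forall x y, rdot (A x) y = rdot x (A y)) ->
  exists D : 'B(H), (forall x y, rdot (D x) y = rdot x (D y)) /\
    (forall x, D (D x) = x - A x).
Proof.
move=> Ac As.
have A1 x : nrm (A x) <= nrm x.
  by rewrite nrm_le_sqn ?nrm_ge0// nrm_sqr.
pose Y := fix Y n : 'B(H) := if n is n.+1
  then halfop (addop A (compop (Y n) (Y n))) else halfop (subop A A).
pose y := fix y n : R := if n is n.+1 then (1 + y n ^+ 2) / 2 else 0.
have YS n x : Y n.+1 x = (2^-1 : R)%:C *: (A x + Y n (Y n x)) by [].
have Y0 x : Y 0%N x = 0 by rewrite /= subrr scaler0.
have ySE n : y n.+1 = (1 + y n ^+ 2) / 2 by [].
have y01 n : 0 <= y n <= 1.
  by elim: n => [|n]; [rewrite /= lexx ler01 | rewrite ySE !expr2; nra].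
have yS n : y n <= y n.+1.
  by rewrite ySE; have := sqr_ge0 (y n - 1); rewrite !expr2; lra.
have Yy n x : nrm (Y n x) <= y n * nrm x.
  elim: n x => [|n IH] x; first by rewrite Y0 nrm0 mul0r.
  rewrite YS nrmZ ?invr_ge0// ySE.
  have := nrmD (A x) (Y n (Y n x)); have := IH (Y n x); have := IH x.
  have := A1 x; have /andP[yn _] := y01 n => h1 h2 h3 h4.
  have : y n * nrm (Y n x) <= y n * (y n * nrm x) by rewrite ler_wpM2l.
  by rewrite !expr2; lra.
have Yd n x : nrm (Y n.+1 x - Y n x) <= (y n.+1 - y n) * nrm x.
  elim: n x => [|n IH] x.
    by rewrite Y0 !subr0; apply: Yy.
  have -> : Y n.+2 x - Y n.+1 x = (2^-1 : R)%:C *: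
      (Y n.+1 (Y n.+1 x - Y n x) + (Y n.+1 (Y n x) - Y n (Y n x))).
    rewrite linearB addrA subrK !YS -scalerBr; congr (_ *: _).
    by rewrite opprD addrACA subrr add0r.
  rewrite nrmZ ?invr_ge0//.
  have := nrmD (Y n.+1 (Y n.+1 x - Y n x)) (Y n.+1 (Y n x) - Y n (Y n x)).
  have := Yy n.+1 (Y n.+1 x - Y n x); have := IH (Y n x); have := IH x.
  have := Yy n x => h1 h2 h3 h4 h5.
  have /andP[yn1 _] := y01 n.+1.
  have : y n.+1 * nrm (Y n.+1 x - Y n x) <= y n.+1 * ((y n.+1 - y n) * nrm x).
    by rewrite ler_wpM2l.
  have : (y n.+1 - y n) * nrm (Y n x) <= (y n.+1 - y n) * (y n * nrm x).
    by rewrite ler_wpM2l// subr_ge0.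
  have -> : y n.+2 - y n.+1 = (y n.+1 * y n.+1 - y n * y n) / 2.
    have := ySE n.+1; have := ySE n; rewrite !expr2.
    move: (y n) (y n.+1) (y n.+2) => a b c e1 e2.
    by rewrite e2 [X in _ - X]e1; field.
  by lra.
have y1 n : y n <= 1 by have /andP[] := y01 n.
have [L LY L1] := op_limit yS y1 Yy Yd.
have Lsym x z : rdot (L x) z = rdot x (L z).
  have Ysym n u v : rdot (Y n u) v = rdot u (Y n v).
    elim: n u v => [|n IH] u v; first by rewrite !Y0 rdot0l rdot0r.
    by rewrite !YS rdotZl rdotZr rdotDl rdotDr As !IH.
  apply/eqP; rewrite -subr_eq0 -normr_le0; apply/ler_addgt0Pr => e e0.
  have e2 : 0 < e / 2 by lra.
  have [N hN] := sqn_cvg_rdot z (LY x) e2.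
  have [N' hN'] := sqn_cvg_rdot x (LY z) e2.
  have := hN _ (leq_maxl N N'); have := hN' _ (leq_maxr N N').
  rewrite (Ysym _ x z) (rdotC (Y _ z) x) (rdotC (L z) x) !ltr_norml !ler_norml.
  by move=> /andP[? ?] /andP[? ?]; apply/andP; split; lra.
have LE x : L x = (2^-1 : R)%:C *: (A x + L (L x)).
  apply: (@sqn_cvg_unique _ _ (fun n => Y n.+1 x)).
    by move=> e /(LY x)[N hN]; exists N => n Nn; apply: hN; apply: leqW.
  have cA : sqn_cvg (fun=> A x) (A x).
    by move=> e e0; exists 0%N => n _; rewrite subrr sqn0.
  have cL : sqn_cvg (fun n => Y n (Y n x)) (L (L x)).
    move=> e e0; have e4 : 0 < e / 4 by lra.
    have [N hN] := LY x _ e4; have [N' hN'] := LY (L x) _ e4.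
    exists (maxn N N') => n; rewrite geq_max => /andP[/hN h /hN' h'].
    apply: le_lt_trans (sqn_dist_le (Y n (L x)) _ _) _.
    have : sqn (Y n (Y n x) - Y n (L x)) <= sqn (Y n x - L x).
      rewrite -linearB -[leRHS]nrm_sqr -nrm_le_sqn ?nrm_ge0//.
      by apply: le_trans (Yy _ _) _; rewrite ler_piMl ?nrm_ge0.
    by lra.
  exact: sqn_cvgZ (sqn_cvgD cA cL).
exists (subop (idop H) L); split=> x.
  by move=> z; rewrite /= rdotBl rdotBr Lsym.
rewrite /= linearB.
have LL : L x + L x = A x + L (L x).
  rewrite -mulr2n -scaler_nat {1}LE scalerA -(rmorph_nat (real_complex R)).
  by rewrite -rmorphM mulfV ?pnatr_eq0// scale1r.
have -> : L (L x) = L x + L x - A x by rewrite LL addrC addKr.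
by rewrite opprB [_ - _ - L x]addrAC addrK addrA subrK.
Qed.

(** The Neumann series, as the limit of the iteration [Z' = 1 + A Z]. *)
Lemma op_inverse_ex H (A : 'B(H)) (q : R) : 0 <= q < 1 ->
  (forall x, nrm (A x) <= q * nrm x) ->
  exists Z : 'B(H), (forall x, Z x - A (Z x) = x) /\ (forall x, Z (x - A x) = x).
Proof.
move=> /andP[q0 q1] Aq.
pose Z := fix Z n : 'B(H) := if n is n.+1
  then addop (idop H) (compop A (Z n)) else subop A A.
pose z := fix z n : R := if n is n.+1 then 1 + q * z n else 0.
have ZS n x : Z n.+1 x = x + A (Z n x) by [].
have Z0 x : Z 0%N x = 0 by rewrite /= subrr.
have zSE n : z n.+1 = 1 + q * z n by [].
have zS n : z n <= z n.+1.
  by elim: n => [|n IH]; [rewrite /= mulr0 addr0 | rewrite !zSE lerD2l ler_wpM2l].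
have zM n : z n <= (1 - q)^-1.
  have q1' : 0 < 1 - q by rewrite subr_gt0.
  rewrite -[leRHS]mul1r ler_pdivlMr//.
  by elim: n => [|n IH]; [rewrite mul0r | rewrite zSE; nra].
have Zz n x : nrm (Z n x) <= z n * nrm x.
  elim: n x => [|n IH] x; first by rewrite Z0 nrm0 mul0r.
  rewrite ZS zSE mulrDl mul1r; apply: le_trans (nrmD _ _) _; rewrite lerD2l.
  by apply: le_trans (Aq _) _; rewrite -mulrA ler_wpM2l.
have Zd n x : nrm (Z n.+1 x - Z n x) <= (z n.+1 - z n) * nrm x.
  elim: n x => [|n IH] x; first by rewrite Z0 !subr0; apply: Zz.
  rewrite (ZS n.+1) (ZS n) opprD addrACA subrr add0r -linearB.
  apply: le_trans (Aq _) _.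
  have -> : z n.+2 - z n.+1 = q * (z n.+1 - z n).
    by rewrite [z n.+2]zSE [X in _ - X]zSE; ring.
  by rewrite -[leRHS]mulrA; apply: ler_wpM2l => //; exact: IH.
have [L LZ _] := op_limit zS zM Zz Zd.
have AL x : sqn_cvg (fun n => A (Z n x)) (A (L x)).
  move=> e e0; have [N hN] := LZ x _ e0; exists N => n /hN.
  rewrite -linearB; apply: le_lt_trans; rewrite -[leRHS]nrm_sqr -nrm_le_sqn ?nrm_ge0//.
  by apply: le_trans (Aq _) _; rewrite ler_piMl ?nrm_ge0 ?ltW.
have cx x : sqn_cvg (fun=> x) (x : H).
  by move=> e e0; exists 0%N => n _; rewrite subrr sqn0.
have ZS' x : sqn_cvg (fun n => Z n.+1 x) (L x).
  by move=> e /(LZ x)[N hN]; exists N => n Nn; apply: hN; apply: leqW.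
have ZA n x : A (Z n x) = Z n (A x).
  elim: n => [|n IH]; first by rewrite !Z0 linear0.
  by rewrite !ZS linearD IH.
exists L; split=> x.
  apply/eqP; rewrite subr_eq; apply/eqP.
  exact: sqn_cvg_unique (ZS' x) (sqn_cvgD (cx x) (AL x)).
rewrite linearB; apply/eqP; rewrite subr_eq; apply/eqP.
apply: sqn_cvg_unique (ZS' x) (sqn_cvgD (cx x) _).
by have := LZ (A x); congr sqn_cvg; apply/funext => n; exact: esym (ZA n x).
Qed.

End OperatorLimits.

(** * Contractions and their defect operators *)

Section Isometries.
Context {R : realType}.
Implicit Types H K L : hilbertType R.

Definition isometric H K (V : bounded_op H K) : Prop :=
  forall x y, rdot (V x) (V y) = rdot x y.

Definition contractive H K (T : bounded_op H K) : Prop :=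
  forall x, sqn (T x) <= sqn x.

Definition strictly_contractive H K (T : bounded_op H K) : Prop :=
  exists2 q : R, 0 <= q < 1 & forall x, sqn (T x) <= q * sqn x.

Lemma isometric_of_sqn H K (V : bounded_op H K) :
  (forall x, sqn (V x) = sqn x) -> isometric V.
Proof.
move=> h x y; have := h (x + y); rewrite linearD !sqnD !h; lra.
Qed.

Lemma sqn_isometric H K (V : bounded_op H K) x : isometric V -> sqn (V x) = sqn x.
Proof. by move=> h; apply: h. Qed.

Lemma adj_isometric H K (V : bounded_op H K) x : isometric V -> adj V (V x) = x.
Proof. by move=> h; apply: rdot_inj => y; rewrite adjPl h. Qed.

Lemma isometric_comp H K L (V : bounded_op K L) (W : bounded_op H K) :
  isometric V -> isometric W -> isometric (compop V W).
Proof. by move=> hV hW x y; rewrite /= hV hW. Qed.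

Lemma adj_sqn_le H K (T : bounded_op H K) (M : R) : 0 <= M ->
  (forall x, sqn (T x) <= M * sqn x) -> forall y, sqn (adj T y) <= M * sqn y.
Proof. by move=> M0; apply: adjoint_sqn_le M0 (@adjP _ _ _ T). Qed.

Lemma contractive_adj H K (T : bounded_op H K) : contractive T -> contractive (adj T).
Proof.
move=> h y; rewrite -[leRHS]mul1r; apply: adj_sqn_le => // x.
by rewrite mul1r.
Qed.

Lemma strictly_contractive_adj H K (T : bounded_op H K) :
  strictly_contractive T -> strictly_contractive (adj T).
Proof.
by move=> [q q01 hq]; exists q => //; case/andP: q01 => q0 _; apply: adj_sqn_le.
Qed.

Lemma strictly_contractiveW H K (T : bounded_op H K) :
  strictly_contractive T -> contractive T.
Proof.
move=> [q /andP[q0 /ltW q1] hq] x; apply: le_trans (hq x) _.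
by rewrite ler_piMl ?sqn_ge0.
Qed.

Lemma strictly_contractive_comp H K L (S : bounded_op K L) (T : bounded_op H K) :
  contractive S -> strictly_contractive T -> strictly_contractive (compop S T).
Proof.
by move=> hS [q q01 hq]; exists q => // x; apply: le_trans (hS _) (hq x).
Qed.

Lemma adjK H K (T : bounded_op H K) x : adj (adj T) x = T x.
Proof. by apply: rdot_inj => y; rewrite adjPl adjP. Qed.

(** The defect operator [D = sqrt (1 - T^* T)] makes [h |-> (T h, D h)] an
  isometry. *)
Lemma defect_op_ex H (T : 'B(H)) : contractive T ->
  exists2 D : 'B(H), (forall x y, rdot (D x) y = rdot x (D y)) &
    (forall x y, rdot (D x) (D y) = rdot x y - rdot (T x) (T y)).
Proof.
move=> hT.
have [x|x y|D [Dsym DD]] := @op_sqrt_ex _ _ (compop (adj T) T).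
- exact: le_trans (contractive_adj hT _) (hT x).
- by rewrite /= adjPl adjP.
exists D => // x y; rewrite Dsym DD /= rdotBr -adjP.
by rewrite rdotC.
Qed.

Lemma defect_inverse_ex H (T : 'B(H)) : strictly_contractive T ->
  exists Z : 'B(H), [/\ forall x y, rdot (Z x) y = rdot x (Z y),
    forall x, Z x - adj T (T (Z x)) = x & forall x, Z (x - adj T (T x)) = x].
Proof.
move=> hT; have [q q01 hq] := hT; have /andP[q0 q1] := q01.
have [x|Z [Z1 Z2]] := @op_inverse_ex _ _ (compop (adj T) T) q q01.
  rewrite nrm_le_sqn ?mulr_ge0 ?nrm_ge0// exprMn nrm_sqr /=.
  apply: le_trans (adj_sqn_le q0 hq _) _; rewrite expr2 -mulrA.
  by rewrite ler_wpM2l.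
exists Z; split=> // x y.
transitivity (rdot (Z x) (Z y) - rdot (T (Z x)) (T (Z y))).
  by rewrite -[in LHS](Z1 y) rdotBr -adjP.
by rewrite -[in RHS](Z1 x) rdotBl adjPl.
Qed.

(** The inverse square root [P] of [1 - T^* T], as [D Z] with [D] the square root
  and [Z] the inverse. *)
Lemma defect_isqrt_ex H (T : 'B(H)) : strictly_contractive T ->
  exists P : 'B(H), [/\ forall x y, rdot (P x) y = rdot x (P y),
    forall x, P (P x - adj T (T (P x))) = x &
    forall x, P (P (x - adj T (T x))) = x].
Proof.
move=> hT; have [Z [Zsym Z1 Z2]] := defect_inverse_ex hT.
have [D Dsym DD] := defect_op_ex (strictly_contractiveW hT).
have DDE x : D (D x) = x - adj T (T x).
  by apply: rdot_inj => y; rewrite Dsym DD rdotBl adjPl.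
have DZ x : D (Z x) = Z (D x).
  have h : D x = D (Z x) - adj T (T (D (Z x))) by rewrite -DDE [D (D (Z x))]DDE Z1.
  by rewrite [in RHS]h Z2.
exists (compop D Z); split=> x /=.
- by move=> y; rewrite Dsym Zsym DZ.
- by rewrite Z2 DDE Z1.
- by rewrite Z2 -DZ DDE Z1.
Qed.

End Isometries.

(** * Operators on square-summable sequences *)

Section L2Operators.
Context {R : realType}.
Implicit Types H K : hilbertType R.

Section Mk.
Context {H K : hilbertType R} (f : H -> nat -> K).
Hypothesis lf : forall n, linear (f^~ n).
Hypothesis bf : exists M : R, forall x N, \sum_(n < N) sqn (f x n) <= M * sqn x.

Lemma mkl2_sqsummable x : sqsummable (f x).
Proof. by have [M hM] := bf; exists (M * sqn x). Qed.

Lemma mkl2_linear : linear (fun x => mkl2 (mkl2_sqsummable x)).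
Proof. by move=> c x y; apply: l2_ext => n; exact: lf. Qed.

Lemma mkl2_bounded :
  exists M : R, forall x, sqn (mkl2 (mkl2_sqsummable x)) <= M * sqn x.
Proof. by have [M hM] := bf; exists M => x; apply: l2_sqn_le => N; apply: hM. Qed.

Definition mkl2op : bounded_op H (l2 K) := mkop mkl2_linear mkl2_bounded.

End Mk.

(** The offset [k] allows for the finitely many vanishing terms that a shift
  inserts. *)
Lemma rdot_l2_eq H K (x y : l2 H) (x' y' : l2 K) (k : nat) :
  (forall N, \sum_(n < (N + k)%N) rdot (x n) (y n) =
             \sum_(n < N) rdot (x' n) (y' n)) -> rdot x y = rdot x' y'.
Proof.
move=> h; have c1 := @l2_rdot_cvg _ _ x y; have c2 := @l2_rdot_cvg _ _ x' y'.
rewrite -(cvg_shiftn k) /= in c1.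
by move: c1; under eq_fun do rewrite h; move=> c1; apply: cvg_unique c1 c2.
Qed.

Section Coordinates.
Context {H : hilbertType R}.

Let e0f (x : H) n : H := if n is 0%N then x else 0.

Let e0_linear n : linear (e0f^~ n).
Proof. by move=> c x y; case: n => //= n; rewrite scaler0 addr0. Qed.

Let e0_bounded :
  exists M : R, forall x N, \sum_(n < N) sqn (e0f x n) <= M * sqn x.
Proof.
exists 1 => x [|N]; first by rewrite big_ord0 mulr_ge0 ?sqn_ge0.
rewrite big_ord_recl /= big1 ?addr0 ?mul1r// => i _; exact: sqn0.
Qed.

Definition l2_e0 : bounded_op H (l2 H) := mkl2op e0_linear e0_bounded.

Let Sf (x : l2 H) n : H := if n is n.+1 then x n else 0.

Let S_linear n : linear (Sf^~ n).
Proof. by move=> c x y; case: n => //=; rewrite scaler0 addr0. Qed.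

Let S_bounded :
  exists M : R, forall x N, \sum_(n < N) sqn (Sf x n) <= M * sqn x.
Proof.
exists 1 => x [|N]; first by rewrite big_ord0 mulr_ge0 ?sqn_ge0.
by rewrite big_ord_recl /= sqn0 add0r mul1r; apply: l2_partial.
Qed.

Definition l2_shift : 'B(l2 H) := mkl2op S_linear S_bounded.

Let Bf (x : l2 H) n : H := x n.+1.

Let B_linear n : linear (Bf^~ n).
Proof. by []. Qed.

Let B_bounded :
  exists M : R, forall x N, \sum_(n < N) sqn (Bf x n) <= M * sqn x.
Proof.
exists 1 => x N; rewrite mul1r; apply: le_trans (l2_partial x N.+1).
by rewrite big_ord_recl /= lerDr sqn_ge0.
Qed.

Definition l2_back : 'B(l2 H) := mkl2op B_linear B_bounded.

Lemma l2_shift_back x y : rdot (l2_shift x) y = rdot x (l2_back y).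
Proof.
apply: (@rdot_l2_eq _ _ _ _ _ _ 1) => N.
by rewrite addn1 big_ord_recl /= rdot0l add0r.
Qed.

Lemma l2_e0_adj h y : rdot (l2_e0 h) y = rdot h (y 0%N).
Proof.
have c1 := @l2_rdot_cvg _ _ (l2_e0 h) y; rewrite -(cvg_shiftn 1) /= in c1.
suff c2 : (fun N => \sum_(n < (N + 1)%N) rdot (l2_e0 h n) (y n)) @ \oo -->
  rdot h (y 0%N) by apply: cvg_unique c1 c2.
have -> : (fun N => \sum_(n < (N + 1)%N) rdot (l2_e0 h n) (y n)) =
    (fun=> rdot h (y 0%N)).
  apply/funext => N; rewrite addn1 big_ord_recl /= big1 ?addr0// => i _.
  exact: rdot0l.
exact: cvg_cst.
Qed.

Lemma l2_backK x : l2_back (l2_shift x) = x.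
Proof. by apply: l2_ext. Qed.

Lemma l2_back_e0 h : l2_back (l2_e0 h) = 0.
Proof. by apply: l2_ext. Qed.

Lemma l2_shift_isometric : isometric l2_shift.
Proof. by move=> x y; rewrite l2_shift_back l2_backK. Qed.

Lemma sqn_e0 h : sqn (l2_e0 h) = sqn h.
Proof. exact: l2_e0_adj. Qed.

(** Prepending [h] to the sequence [y] is [l2_e0 h + l2_shift y]. *)
Lemma sqn_e0_shift h y : sqn (l2_e0 h + l2_shift y) = sqn h + sqn y.
Proof.
rewrite sqnD sqn_e0 (sqn_isometric _ l2_shift_isometric).
by rewrite rdotC l2_shift_back l2_back_e0 rdot0r mulr0 addr0.
Qed.

Lemma iter_back n (x : l2 H) : iter n l2_back x 0%N = x n.
Proof. by elim: n x => [//|n IH x]; rewrite iterSr IH. Qed.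

Lemma rdot_coord n h y : rdot (iter n l2_shift (l2_e0 h)) y = rdot h (y n).
Proof.
rewrite -iter_back -l2_e0_adj; elim: n y => [//|n IH y].
by rewrite iterS l2_shift_back IH -iterSr.
Qed.

End Coordinates.

Section Amplification.
Context {H : hilbertType R} (A : 'B(H)).

Let Af (x : l2 H) n : H := A (x n).

Let A_linear n : linear (Af^~ n).
Proof. by move=> c x y; rewrite /Af linearP. Qed.

Let A_bounded :
  exists M : R, forall x N, \sum_(n < N) sqn (Af x n) <= M * sqn x.
Proof.
have [M M0 hM] := op_bound A; exists M => x N.
apply: (@le_trans _ _ (\sum_(n < N) (M * sqn (x n)))).
  by apply: ler_sum => n _; apply: hM.
by rewrite -mulr_sumr ler_wpM2l// l2_partial.
Qed.

Definition l2_amp : 'B(l2 H) := mkl2op A_linear A_bounded.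

Lemma l2_amp_shift x : l2_amp (l2_shift x) = l2_shift (l2_amp x).
Proof. by apply: l2_ext => -[|n//]; exact: (linear0 A). Qed.

Lemma l2_amp_e0 h : l2_amp (l2_e0 h) = l2_e0 (A h).
Proof. by apply: l2_ext => -[//|n]; exact: (linear0 A). Qed.

End Amplification.

Lemma l2_amp_adj H (A B : 'B(H)) : (forall x y, rdot (A x) y = rdot x (B y)) ->
  forall x y, rdot (l2_amp A x) y = rdot x (l2_amp B y).
Proof.
move=> h x y; apply: (@rdot_l2_eq _ _ _ _ _ _ 0) => N; rewrite addn0.
by apply: eq_bigr => n _; apply: h.
Qed.

End L2Operators.

(** * Operators on orthogonal sums *)

Section HsumOperators.
Context {R : realType}.
Implicit Types H K L : hilbertType R.

Section Pair.
Context {H K L : hilbertType R} (S : bounded_op H K) (T : bounded_op H L).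

Lemma linear_pair : linear (fun x => (S x, T x) : hsum K L).
Proof. by move=> c x y; apply: hsumP; rewrite /= linearP. Qed.

Lemma bounded_pair : exists M : R, forall x,
  sqn ((S x, T x) : hsum K L) <= M * sqn x.
Proof.
have [M M0 hM] := op_bound S; have [N N0 hN] := op_bound T.
by exists (M + N) => x; rewrite sqn_hsum mulrDl; apply: lerD; [apply: hM | apply: hN].
Qed.

Definition pairop : bounded_op H (hsum K L) := mkop linear_pair bounded_pair.
End Pair.

Section Projections.
Context {K L : hilbertType R}.

Lemma linear_fst : linear (fun x : hsum K L => x.1).
Proof. by move=> c x y. Qed.

Lemma linear_snd : linear (fun x : hsum K L => x.2).
Proof. by move=> c x y. Qed.

Lemma bounded_fst : exists M : R, forall x : hsum K L, sqn x.1 <= M * sqn x.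
Proof. by exists 1 => x; rewrite mul1r sqn_hsum lerDl sqn_ge0. Qed.

Lemma bounded_snd : exists M : R, forall x : hsum K L, sqn x.2 <= M * sqn x.
Proof. by exists 1 => x; rewrite mul1r sqn_hsum lerDr sqn_ge0. Qed.

Definition fstop : bounded_op (hsum K L) K := mkop linear_fst bounded_fst.
Definition sndop : bounded_op (hsum K L) L := mkop linear_snd bounded_snd.

Definition inlop : bounded_op K (hsum K L) := pairop (idop K) (zeroop K L).
End Projections.

Definition dsumop K L (S : 'B(K)) (T : 'B(L)) : 'B(hsum K L) :=
  pairop (compop S fstop) (compop T sndop).

Lemma dsumopE K L (S : 'B(K)) (T : 'B(L)) x :
  dsumop S T x = (S x.1, T x.2).
Proof. by []. Qed.

Lemma dsumop_adj K L (S : 'B(K)) (T : 'B(L)) x :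
  adj (dsumop S T) x = (adj S x.1, adj T x.2).
Proof.
apply/esym/(@adj_unique _ _ _ (dsumop S T) (dsumop (adj S) (adj T))) => u v.
by rewrite !rdot_hsum /= !adjP.
Qed.

Lemma dsumop_isometric K L (S : 'B(K)) (T : 'B(L)) :
  isometric S -> isometric T -> isometric (dsumop S T).
Proof. by move=> hS hT x y; rewrite !rdot_hsum /= hS hT. Qed.

Lemma inlop_adj K L (x : hsum K L) : adj inlop x = x.1.
Proof.
apply/esym/(@adj_unique _ _ _ (@inlop K L) fstop) => u v.
by rewrite rdot_hsum /= rdot0l addr0.
Qed.

Lemma inlop_isometric K L : isometric (@inlop K L).
Proof. by move=> x y; rewrite rdot_hsum /= rdot0l addr0. Qed.

End HsumOperators.

(** * The shift model of an isometric lift *)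

Section Lifts.
Context {R : realType}.
Implicit Types H K M : hilbertType R.

(** Taking adjoints, [V^*] extends [T^*] if and only if the compression
  [adj iota] to [H] intertwines [V] and [T]; the second form is stable under all
  the constructions below. *)
Definition isolift H K (iota : bounded_op H K) (T : 'B(H)) (V : 'B(K)) : Prop :=
  isometric V /\ forall k, adj iota (V k) = T (adj iota k).

Lemma lift_adj H K (iota : bounded_op H K) (T : 'B(H)) (V : 'B(K)) :
  (forall k, adj iota (V k) = T (adj iota k)) ->
  forall h, adj V (iota h) = iota (adj T h).
Proof.
by move=> h x; apply: rdot_inj => k; rewrite adjPl [LHS]adjP h [RHS]adjP adjPl.
Qed.

(** The operator [Q (+) I] on [H (+) (K (-) H)]. *)
Definition ext_id H K (iota : bounded_op H K) (Q : 'B(H)) : 'B(K) :=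
  addop (compop iota (compop Q (adj iota)))
        (subop (idop K) (compop iota (adj iota))).

Lemma ext_idE H K (iota : bounded_op H K) (Q : 'B(H)) k :
  ext_id iota Q k = iota (Q (adj iota k)) + (k - iota (adj iota k)).
Proof. by []. Qed.

Section Intertwine.
Context {H K : hilbertType R} (V : 'B(K)) (t : bounded_op K (l2 H)).

Lemma intertwine_shift : (forall k, t (adj V k) = l2_back (t k)) ->
  forall y, adj t (l2_shift y) = V (adj t y).
Proof.
move=> h y; apply: rdot_inj => k; rewrite adjPl l2_shift_back -h.
by rewrite [RHS]adjP adjPl.
Qed.

Lemma intertwine_back : (forall k, t (V k) = l2_shift (t k)) ->
  forall y, adj t (l2_back y) = adj V (adj t y).
Proof.
move=> h y; apply: rdot_inj => k; rewrite adjPl [RHS]adjPl [RHS]adjPl h.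
by rewrite [LHS]rdotC -l2_shift_back rdotC.
Qed.
End Intertwine.

(** An isometric lift [V] of a strict contraction [T] reduces to a unilateral
  shift of multiplicity [H] on the smallest reducing subspace containing [H].
  Its wandering vectors are [w h = (1 - V T^* ) P h], where [P] is the inverse
  square root of [1 - T T^*]: they are annihilated by [V^*], and the factor [P]
  makes [w] an isometry. The adjoint [c] of [w] and the powers of [V^*] give the
  coordinates of a vector in the model. The coordinates of [h] itself depend
  only on [T], and [h] lies in the model space since [T^*n h] tends to [0]. *)
Section Model.
Context {H : hilbertType R} (T P : 'B(H)).
Hypothesis T_strict : strictly_contractive T.
Hypothesis Psym : forall x y, rdot (P x) y = rdot x (P y).
Hypothesis P1 : forall x, P (P x - T (adj T (P x))) = x.
Hypothesis P2 : forall x, P (P (x - T (adj T x))) = x.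

Definition model_vec h n : H := P (iter n (adj T) h - T (iter n.+1 (adj T) h)).

Section Lift.
Context {K : hilbertType R} (iota : bounded_op H K) (V : 'B(K)).
Hypothesis iota_iso : isometric iota.
Hypothesis V_lift : isolift iota T V.

Let p := adj iota.
Let Va := adj V.
Let Ta := adj T.

Let V_iso : isometric V. Proof. by case: V_lift. Qed.
Let pV k : p (V k) = T (p k). Proof. by case: V_lift. Qed.
Let VaV k : Va (V k) = k. Proof. exact: adj_isometric. Qed.
Let pK h : p (iota h) = h. Proof. exact: adj_isometric. Qed.
Let Vai h : Va (iota h) = iota (Ta h). Proof. exact: lift_adj. Qed.

Let c k : H := P (p k - T (p (Va k))).
Let w h : K := iota (P h) - V (iota (Ta (P h))).

Let Va_w h : Va (w h) = 0.
Proof. by rewrite /w linearB VaV Vai subrr. Qed.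

Let p_w h : p (w h) = P h - T (Ta (P h)).
Proof. by rewrite /w linearB pV !pK. Qed.

Let c_w h : c (w h) = h.
Proof. by rewrite /c Va_w p_w (linear0 p) (linear0 T) subr0 P1. Qed.

Let c_adj k h : rdot (c k) h = rdot k (w h).
Proof.
rewrite /c /w Psym rdotBl rdotBr adjPl; congr (_ - _).
by rewrite adjP adjPl adjPl.
Qed.

(** Bessel's inequality for the orthogonal ranges of [V] and [w]. *)
Let c_le k : sqn (c k) <= sqn k - sqn (Va k).
Proof.
have := sqn_ge0 (k - V (Va k) - w (c k)).
have ww : sqn (w (c k)) = sqn (c k) by rewrite /sqn -c_adj c_w.
have -> : sqn (k - V (Va k) - w (c k)) =
    sqn (k - V (Va k)) - sqn (c k).
  rewrite sqnB ww rdotBl -c_adj adjP Va_w rdot0r subr0 -/(sqn _); lra.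
rewrite sqnB (sqn_isometric _ V_iso) rdotC adjP -/(sqn _).
by rewrite -/(sqn (Va k)); lra.
Qed.

Let model_coord k n : H := c (iter n Va k).

Let model_linear n : linear (model_coord^~ n).
Proof.
have il : linear (iter n Va).
  by elim: n => [|n IH] a x y //=; rewrite IH; exact: (linearP (adj V)).
move=> a x y; rewrite /model_coord il.
exact: (linearP (compop P (subop p (compop T (compop p Va))))).
Qed.

Let model_bounded : exists M : R, forall k N,
  \sum_(n < N) sqn (model_coord k n) <= M * sqn k.
Proof.
exists 1 => k N; rewrite mul1r.
(* the bounds of the coordinates telescope *)
suff : \sum_(n < N) sqn (model_coord k n) <= sqn k - sqn (iter N Va k).
  by have := sqn_ge0 (iter N Va k); lra.
elim: N => [|N IH]; first by rewrite big_ord0 subrr.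
by rewrite big_ord_recr /=; have := c_le (iter N Va k); rewrite /model_coord; lra.
Qed.

Definition to_model : bounded_op K (l2 H) := mkl2op model_linear model_bounded.

Let to_modelE k n : to_model k n = c (iter n Va k). Proof. by []. Qed.

Let c_V k : c (V k) = 0.
Proof. by rewrite /c VaV pV subrr; exact: linear0. Qed.

Let c_0 : c 0 = 0.
Proof. exact: (linear0 (compop P (subop p (compop T (compop p Va))))). Qed.

Lemma to_model_V k : to_model (V k) = l2_shift (to_model k).
Proof.
apply: l2_ext => -[|n]; first exact: c_V.
by rewrite to_modelE iterSr VaV.
Qed.

Lemma to_model_Va k : to_model (adj V k) = l2_back (to_model k).
Proof. by apply: l2_ext => n; rewrite to_modelE -iterSr. Qed.

Lemma of_model_shift y : adj to_model (l2_shift y) = V (adj to_model y).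
Proof. exact: intertwine_shift to_model_Va _. Qed.

Lemma to_modelK y : to_model (adj to_model y) = y.
Proof.
have h0 h : adj to_model (l2_e0 h) = w h.
  apply: rdot_inj => k; rewrite adjPl l2_e0_adj to_modelE.
  by rewrite rdotC c_adj rdotC.
have h1 h : to_model (w h) = l2_e0 h.
  apply: l2_ext => -[|n]; first exact: c_w.
  rewrite to_modelE iterSr Va_w (_ : iter n Va 0 = 0) ?c_0//.
  by elim: n => [//|n]; rewrite iterS => ->; exact: (linear0 (adj V)).
(* the adjoint is determined by its values on sequences with a single entry *)
have hn n h : to_model (adj to_model (iter n l2_shift (l2_e0 h))) =
    iter n l2_shift (l2_e0 h).
  elim: n => [|n IH]; first by rewrite -[iter 0 _ _]/(l2_e0 h) h0 h1.
  by rewrite iterS of_model_shift to_model_V IH.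
apply: l2_ext => n; apply: rdot_inj => h.
rewrite rdotC -rdot_coord rdotC [RHS]rdotC -rdot_coord [RHS]rdotC.
by rewrite adjP adjPl hn.
Qed.

Lemma to_model_iota h : to_model (iota h) =1 model_vec h.
Proof.
move=> n; rewrite to_modelE.
have -> : iter n Va (iota h) = iota (iter n Ta h).
  by elim: n => [//|n IH]; rewrite iterS IH Vai.
by rewrite /c Vai !pK.
Qed.

Lemma of_model_iota h : adj to_model (to_model (iota h)) = iota h.
Proof.
apply/eqP; rewrite eq_sym -subr_eq0; apply/eqP/sqn_eq0.
have -> : sqn (iota h - adj to_model (to_model (iota h))) =
    sqn h - sqn (to_model (iota h)).
  rewrite sqnB -adjP -/(sqn _) (sqn_isometric _ iota_iso).
  have -> : sqn (adj to_model (to_model (iota h))) = sqn (to_model (iota h)).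
    by rewrite /sqn -adjP to_modelK.
  lra.
have mv n : sqn (model_vec h n) = sqn (iter n Ta h) - sqn (iter n.+1 Ta h).
  rewrite /model_vec -/Ta iterS; move: (iter n Ta h) => x.
  by rewrite /sqn Psym P2 rdotBl adjP.
have mvN N : \sum_(n < N) sqn (to_model (iota h) n) = sqn h - sqn (iter N Ta h).
  rewrite (eq_bigr (fun n : 'I_N => sqn (model_vec h n))); last first.
    by move=> n _; rewrite to_model_iota.
  elim: N => [|N IH]; first by rewrite big_ord0 subrr.
  by rewrite big_ord_recr /= IH mv -iterS; lra.
have [q q01 Tq] := T_strict; have /andP[q0 q1] := q01.
have Taq N : sqn (iter N Ta h) <= q ^+ N * sqn h.
  elim: N => [|N IH]; first by rewrite mul1r.
  rewrite iterS exprS -mulrA; apply: le_trans (adj_sqn_le q0 Tq _) _.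
  by rewrite ler_wpM2l.
apply/eqP; rewrite eq_le; apply/andP; split; last first.
  rewrite subr_ge0; apply: l2_sqn_le => N; rewrite mvN.
  by have := sqn_ge0 (iter N Ta h); lra.
have qcvg : (fun N => q ^+ N * sqn h) @ \oo --> 0 * sqn h.
  by apply: cvgMl; apply: cvg_expr; rewrite ger0_norm.
rewrite mul0r in qcvg.
have -> : 0 = limn (fun N => q ^+ N * sqn h) by apply/esym/cvg_lim.
apply: limr_ge; first by apply/cvg_ex; exists 0.
apply: nearW => N; apply: le_trans (Taq N).
by have := l2_partial (to_model (iota h)) N; rewrite mvN; lra.
Qed.

End Lift.
End Model.

(** The coordinates [v] are independent of the lift: they are what allows two
  lifts of [T] on different spaces to be identified. *)
Lemma model_ex H (T : 'B(H)) : strictly_contractive T ->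
  exists v : H -> nat -> H, forall K (iota : bounded_op H K) (V : 'B(K)),
    isometric iota -> isolift iota T V ->
    exists t : bounded_op K (l2 H),
      [/\ forall y, t (adj t y) = y, forall k, t (V k) = l2_shift (t k),
          forall k, t (adj V k) = l2_back (t k), forall h n, t (iota h) n = v h n
        & forall h, adj t (t (iota h)) = iota h].
Proof.
move=> T_strict.
have [P [Psym P1 P2]] := defect_isqrt_ex (strictly_contractive_adj T_strict).
have P1' x : P (P x - T (adj T (P x))) = x by rewrite -[RHS]P1 adjK.
have P2' x : P (P (x - T (adj T x))) = x by rewrite -[RHS]P2 adjK.
exists (model_vec T P) => K iota V iota_iso V_lift.
exists (to_model Psym P1' iota_iso V_lift); split.
- exact: to_modelK.
- exact: to_model_V.
- exact: to_model_Va.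
- exact: to_model_iota.
- exact: of_model_iota.
Qed.

End Lifts.

(** * Gluing two isometric lifts of the same operator *)

Section Amalgam.
Context {R : realType} {H K M : hilbertType R}.
Variables (T : 'B(H)) (iotaK : bounded_op H K) (iotaM : bounded_op H M).
Variables (V : 'B(K)) (W : 'B(M)).
Hypothesis T_strict : strictly_contractive T.
Hypothesis iotaK_iso : isometric iotaK.
Hypothesis iotaM_iso : isometric iotaM.
Hypothesis V_lift : isolift iotaK T V.
Hypothesis W_lift : isolift iotaM T W.

(** The model part of [M] is sent to the model part of [K], which identifies the
  two copies of [H], and the rest of [M] is kept. The range of [Z] reduces
  [V (+) W], since the models are isomorphic and reduce [V] and [W]. *)
Lemma amalgam_embedding : exists Z : bounded_op M (hsum K M),
  [/\ isometric Z, forall m, dsumop V W (Z m) = Z (W m),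
      forall x, adj Z (dsumop V W x) = W (adj Z x) &
      forall h, Z (iotaM h) = inlop (iotaK h)].
Proof.
have [v hv] := model_ex T_strict.
have [tK [tKJ tKV tKVa tKi tKJi]] := hv K iotaK V iotaK_iso V_lift.
have [tM [tMJ tMW tMWa tMi tMJi]] := hv M iotaM W iotaM_iso W_lift.
pose Z : bounded_op M (hsum K M) :=
  pairop (compop (adj tK) tM) (subop (idop M) (compop (adj tM) tM)).
have ZE m : Z m = (adj tK (tM m), m - adj tM (tM m)) by [].
have Ziso : isometric Z.
  apply: isometric_of_sqn => m; rewrite sqn_hsum ZE /= sqnB.
  have -> : sqn (adj tK (tM m)) = sqn (tM m) by rewrite /sqn -adjP tKJ.
  have -> : sqn (adj tM (tM m)) = sqn (tM m) by rewrite /sqn -adjP tMJ.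
  by rewrite -adjP -/(sqn _); lra.
have ZW m : dsumop V W (Z m) = Z (W m).
  apply: hsumP; rewrite [LHS]/= [RHS]/= tMW.
    by rewrite (intertwine_shift tKVa).
  by rewrite linearB (intertwine_shift tMWa).
have ZWa m : adj (dsumop V W) (Z m) = Z (adj W m).
  rewrite dsumop_adj !ZE; apply: hsumP; rewrite [LHS]/= [RHS]/= tMWa.
    by rewrite (intertwine_back tKV).
  by rewrite linearB (intertwine_back tMW).
exists Z; split=> // [x|h].
  by apply: rdot_inj => m; rewrite adjPl [LHS]adjP ZWa [RHS]adjP adjPl.
rewrite ZE tMJi subrr; apply: hsumP => //; rewrite [LHS]/= [RHS]/= -[RHS]tKJi.
by congr (adj _ _); apply: l2_ext => n; rewrite tKi.
Qed.

Variables (T2 : 'B(H)) (W2 : 'B(M)).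
Hypothesis W2_lift : isolift iotaM T2 W2.

(** The operator [W2] is transported to the range of [Z] and extended by the
  identity on its orthogonal complement, which reduces [V (+) W]; there both
  orders of the relation hold because the identity commutes with everything. *)
Lemma amalgam : exists V2 : 'B(hsum K M),
  [/\ isolift (compop inlop iotaK) T2 V2,
      forall Q : 'B(H), (forall m, W (W2 m) = W2 (W (ext_id iotaM Q m))) ->
        forall x, dsumop V W (V2 x) =
          V2 (dsumop V W (ext_id (compop inlop iotaK) Q x)) &
      forall Q : 'B(H), (forall m, W2 (W m) = W (W2 (ext_id iotaM Q m))) ->
        forall x, V2 (dsumop V W x) =
          dsumop V W (V2 (ext_id (compop inlop iotaK) Q x))].
Proof.
have [Z [Ziso VZ ZV Zi]] := amalgam_embedding.
have ZK m : adj Z (Z m) = m by apply: adj_isometric.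
set iota := compop inlop iotaK; set V1 := dsumop V W.
have iE h : iota h = Z (iotaM h) by rewrite Zi.
have pE x : adj iota x = adj iotaM (adj Z x).
  by apply: rdot_inj => h; rewrite adjPl iE [RHS]adjPl [RHS]adjPl.
pose V2 : 'B(hsum K M) :=
  addop (compop Z (compop W2 (adj Z))) (subop (idop _) (compop Z (adj Z))).
have V2E x : V2 x = Z (W2 (adj Z x)) + (x - Z (adj Z x)) by [].
have split x : exists a r, x = Z a + r /\ adj Z r = 0.
  exists (adj Z x), (x - Z (adj Z x)); split; first by rewrite addrC subrK.
  by rewrite linearB ZK subrr.
have V2s a r : adj Z r = 0 -> V2 (Z a + r) = Z (W2 a) + r.
  move=> r0; rewrite V2E linearD ZK r0 addr0; congr (_ + _).
  by rewrite addrC addKr.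
have V1s a r : V1 (Z a + r) = Z (W a) + V1 r by rewrite linearD VZ.
have V1r r : adj Z r = 0 -> adj Z (V1 r) = 0.
  by move=> r0; rewrite ZV r0 linear0.
have Qs (Q : 'B(H)) a r : adj Z r = 0 ->
    ext_id iota Q (Z a + r) = Z (ext_id iotaM Q a) + r.
  move=> r0; rewrite !ext_idE pE linearD ZK r0 addr0.
  rewrite !iE (linearD Z) (linearB Z) -!addrA; congr (_ + (_ + _)).
  by rewrite addrC.
exists V2; split.
- split.
    apply: isometric_of_sqn => x; have [a [r [-> r0]]] := split x.
    rewrite V2s// !sqnD !(adjP Z) !r0 !rdot0r !(sqn_isometric _ Ziso).
    by case: W2_lift => W2i _; rewrite (sqn_isometric _ W2i).
  move=> x; have [a [r [-> r0]]] := split x.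
  have ZD b : adj Z (Z b + r) = b by rewrite linearD ZK r0 addr0.
  by rewrite V2s// !pE !ZD; case: W2_lift.
- move=> Q hQ x; have [a [r [-> r0]]] := split x.
  by rewrite Qs// (V2s _ r)// !V1s (V2s _ (V1 r)) ?V1r// hQ.
- move=> Q hQ x; have [a [r [-> r0]]] := split x.
  by rewrite Qs// (V2s _ r)// !V1s (V2s _ (V1 r)) ?V1r// hQ.
Qed.

End Amalgam.

(** * The relation of a single edge *)

Section Halmos.
Context {R : realType} {L : hilbertType R}.

(** Halmos's unitary dilation of a partial isometry [u] with adjoint [v]: the
  kernel of [u] and the cokernel are exchanged with the second copy of [L],
  [[u, 1 - u v], [1 - v u, - v]] as a matrix. *)
Definition halmos (u v : 'B(L)) : 'B(hsum L L) :=
  pairop (addop (compop u fstop) (subop sndop (compop u (compop v sndop))))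
         (subop (subop fstop (compop v (compop u fstop))) (compop v sndop)).

Lemma halmosE u v x : halmos u v x =
  (u x.1 + (x.2 - u (v x.2)), x.1 - v (u x.1) - v x.2).
Proof. by []. Qed.

Variables (u v : 'B(L)).
Hypothesis uvu : forall x, u (v (u x)) = u x.
Hypothesis vuv : forall x, v (u (v x)) = v x.

Lemma halmosK x : halmos v u (halmos u v x) = x.
Proof.
case: x => x y; rewrite [halmos u v _]halmosE halmosE [_.1]/= [_.2]/=.
have -> : v (u x + (y - u (v y))) = v (u x).
  by rewrite linearD (linearB v) vuv subrr addr0.
have -> : u (x - v (u x) - v y) = - u (v y).
  by rewrite !(linearB u) uvu subrr sub0r.
rewrite uvu linearN vuv !opprK; apply: hsumP => /=.
  by rewrite subrK addrC subrK.
by rewrite [u x + _]addrC addrK subrK.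
Qed.

End Halmos.

Lemma halmos_adj (R : realType) (L : hilbertType R) (u v : 'B(L)) :
  (forall x y, rdot (u x) y = rdot x (v y)) ->
  forall x y, rdot (halmos u v x) y = rdot x (halmos v u y).
Proof.
move=> uv x y; have vu a b : rdot (v a) b = rdot a (u b).
  by rewrite rdotC -uv rdotC.
rewrite !halmosE !rdot_hsum [_.1]/= [_.2]/=.
by rewrite !(rdotDl, rdotDr, rdotNl, rdotNr) !(uv, vu); lra.
Qed.

Section Schaffer.
Context {R : realType} {H : hilbertType R}.

Let L := hsum (l2 H) (l2 H).
Let N := hsum L L.

(** A sequence [(y, y')] is shifted by half a step: reading [L] as the sequences
  [y 0, y' 0, y 1, y' 1, ...], this is the unilateral shift. *)
Definition swap_shift : 'B(hsum (l2 H) (l2 H)) := pairop (compop l2_shift sndop) fstop.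

(** Schaffer's isometric dilation. The half steps let the product of two such
  dilations store the two defect vectors in the first entries of the two
  sequences; the second copy of [L] is the room needed by [halmos]. *)
Definition schaffer (T D : 'B(H)) : 'B(hsum H N) :=
  pairop (compop T fstop)
    (addop (compop inlop (compop inlop (compop l2_e0 (compop D fstop))))
           (compop (dsumop swap_shift swap_shift) sndop)).

Lemma schafferE (T D : 'B(H)) h x z : schaffer T D (h, (x, z)) =
  (T h, ((l2_e0 (D h) + l2_shift x.2, x.1), (l2_shift z.2, z.1))).
Proof.
apply: hsumP; first by [].
apply: hsumP; apply: hsumP; last exact: add0r.
- by [].
- exact: add0r.
- exact: add0r.
Qed.

Lemma schaffer_isometric (T D : 'B(H)) :
  (forall x y, rdot (D x) (D y) = rdot x y - rdot (T x) (T y)) ->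
  isometric (schaffer T D).
Proof.
move=> TD; apply: isometric_of_sqn => -[h [x z]]; rewrite schafferE.
rewrite !sqn_hsum [_.1]/= [_.2]/= sqn_e0_shift !(sqn_isometric _ l2_shift_isometric).
by have := TD h h; rewrite -/(sqn _) -/(sqn h) -/(sqn (T h)) /=; lra.
Qed.

End Schaffer.

Section RowColumn.
Context {R : realType} {H : hilbertType R}.
Let L := hsum (l2 H) (l2 H).
Implicit Types A B : 'B(H).

Definition l2_col A B : bounded_op (l2 H) (hsum (l2 H) (l2 H)) :=
  pairop (l2_amp A) (l2_amp B).

Definition l2_row A B : bounded_op (hsum (l2 H) (l2 H)) (l2 H) :=
  addop (compop (l2_amp A) fstop) (compop (l2_amp B) sndop).

Definition pair_shift : 'B(hsum (l2 H) (l2 H)) := dsumop l2_shift l2_shift.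

Lemma l2_col_row A B x y :
  rdot (l2_col A B x) y = rdot x (l2_row (adj A) (adj B) y).
Proof.
by rewrite rdot_hsum rdotDr; congr (_ + _); apply: l2_amp_adj => a b; rewrite adjP.
Qed.

Lemma l2_col_shift A B x : l2_col A B (l2_shift x) = pair_shift (l2_col A B x).
Proof. by apply: hsumP; exact: l2_amp_shift. Qed.

Lemma l2_row_shift A B x : l2_row A B (pair_shift x) = l2_shift (l2_row A B x).
Proof. by rewrite [RHS]linearD -!l2_amp_shift. Qed.

End RowColumn.

(** Ando's argument. The columns [A] and [B] carry the defect vectors of the two
  products [T1 T2] and [T2 T1 Q]; both have the Gram operator [1 - C^* C], which
  is invertible since [C] is a strict contraction. So
  [u = B (1 - C^* C)^-1 A^*] is a partial isometry that maps the column [A] to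
  the column [B], and acting entry by entry on sequences it commutes with the
  shift. *)
Section EdgeUnitary.
Context {R : realType} {H : hilbertType R}.
Variables A1 A2 B1 B2 C : 'B(H).
Hypothesis C_strict : strictly_contractive C.
Hypothesis AE : forall x y,
  rdot (A1 x) (A1 y) + rdot (A2 x) (A2 y) = rdot x y - rdot (C x) (C y).
Hypothesis BE : forall x y,
  rdot (B1 x) (B1 y) + rdot (B2 x) (B2 y) = rdot x y - rdot (C x) (C y).

Let L := hsum (l2 H) (l2 H).

Let gram (X Y : 'B(H)) : (forall x y,
    rdot (X x) (X y) + rdot (Y x) (Y y) = rdot x y - rdot (C x) (C y)) ->
  forall x, adj X (X x) + adj Y (Y x) = x - adj C (C x).
Proof.
by move=> h x; apply: rdot_inj => y; rewrite rdotDl rdotBl !adjPl h.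
Qed.

Lemma edge_unitary_ex : exists U U' : 'B(hsum (hsum (l2 H) (l2 H)) (hsum (l2 H) (l2 H))),
  [/\ cancel U U', cancel U' U, isometric U, isometric U' &
   (forall x, U (dsumop pair_shift pair_shift x) =
               dsumop pair_shift pair_shift (U x)) /\
   (forall g, U (l2_col A1 A2 g, 0) = (l2_col B1 B2 g, 0))].
Proof.
have [Z [Zsym Z1 Z2]] := defect_inverse_ex C_strict.
pose a := l2_col A1 A2; pose b := l2_col B1 B2.
pose ra := l2_row (adj A1) (adj A2); pose rb := l2_row (adj B1) (adj B2).
pose z := l2_amp Z.
have raz y : ra (a (z y)) = y.
  by apply: l2_ext => n; rewrite -[RHS]Z1 -(gram AE).
have rbz y : rb (b (z y)) = y.
  by apply: l2_ext => n; rewrite -[RHS]Z1 -(gram BE).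
have zra y : z (ra (a y)) = y.
  by apply: l2_ext => n; rewrite -[RHS]Z2 -(gram AE).
have zrb y : z (rb (b y)) = y.
  by apply: l2_ext => n; rewrite -[RHS]Z2 -(gram BE).
pose u : 'B(L) := compop b (compop z ra); pose v : 'B(L) := compop a (compop z rb).
have uE x : u x = b (z (ra x)) by [].
have vE x : v x = a (z (rb x)) by [].
have uvu x : u (v (u x)) = u x by rewrite !uE vE raz rbz.
have vuv x : v (u (v x)) = v x by rewrite !vE uE rbz raz.
have uv x y : rdot (u x) y = rdot x (v y).
  rewrite uE vE l2_col_row -/rb (l2_amp_adj Zsym) -/z.
  by rewrite rdotC -l2_col_row rdotC.
have vu x y : rdot (v x) y = rdot x (u y) by rewrite rdotC -uv rdotC.
have us x : u (pair_shift x) = pair_shift (u x).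
  by rewrite !uE l2_row_shift l2_amp_shift l2_col_shift.
have vs x : v (pair_shift x) = pair_shift (v x).
  by rewrite !vE l2_row_shift l2_amp_shift l2_col_shift.
have UK := halmosK uvu vuv; have UK' := halmosK vuv uvu.
exists (halmos u v), (halmos v u); split=> //.
- by move=> x y; rewrite (halmos_adj uv) UK.
- by move=> x y; rewrite (halmos_adj vu) UK'.
have hE x y : halmos u v (x, y) =
  (u x + (y - u (v y)), x - v (u x) - v y) by [].
split=> [[x y]|g].
  have dE (p q : L) : dsumop pair_shift pair_shift ((p, q) : hsum L L) =
      (pair_shift p, pair_shift q) by [].
  rewrite dE !hE dE !(us, vs).
  by rewrite !(linearD pair_shift) !(linearN pair_shift).
rewrite hE (linear0 v) (linear0 u) subrr addr0 subr0.
have -> : u (l2_col A1 A2 g) = b g by rewrite uE zra.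
have -> : v (b g) = a g by rewrite vE zrb.
by rewrite subrr.
Qed.

End EdgeUnitary.

(** If [U V1 V2 = V2 V1 Q U], then [U V1] and [V2 U^-1] satisfy the relation.
  They are still lifts, since [U] only acts on the complement [N] of [H]. *)
Lemma edge_lift_of_unitary (R : realType) (H N : hilbertType R)
    (T1 T2 Q : 'B(H)) (V1 V2 : 'B(hsum H N)) (U U' : 'B(N)) :
  isometric V1 -> isometric V2 -> isometric U -> isometric U' ->
  cancel U U' -> cancel U' U ->
  (forall k, (V1 k).1 = T1 k.1) -> (forall k, (V2 k).1 = T2 k.1) ->
  (forall h n, dsumop (idop H) U (V1 (V2 (h, n))) = V2 (V1 (Q h, U n))) ->
  exists (M : hilbertType R) (iota : bounded_op H M) (W1 W2 : 'B(M)),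
    [/\ isometric iota, isolift iota T1 W1, isolift iota T2 W2 &
        forall m, W1 (W2 m) = W2 (W1 (ext_id iota Q m))].
Proof.
move=> V1i V2i Ui Ui' UK UK' V1l V2l key.
have I : isometric (idop H) by [].
exists (hsum H N), inlop, (compop (dsumop (idop H) U) V1),
  (compop V2 (dsumop (idop H) U')); split.
- exact: inlop_isometric.
- split; first exact: (isometric_comp (dsumop_isometric I Ui) V1i).
  by move=> k; rewrite !inlop_adj; exact: V1l.
- split; first exact: (isometric_comp V2i (dsumop_isometric I Ui')).
  by move=> k; rewrite !inlop_adj [LHS]V2l.
move=> [h n]; have {n} [n ->] : exists n', n = U n' by exists (U' n); rewrite UK'.
have UnE : dsumop (idop H) U' (h, U n) = (h, n) by rewrite dsumopE /= UK.
have QE : ext_id inlop Q (h, U n) = (Q h, U n).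
  rewrite ext_idE inlop_adj.
  by apply: hsumP; [rewrite /= subrr addr0 | rewrite /= subr0 add0r].
have WE k : compop (dsumop (idop H) U) V1 k = dsumop (idop H) U (V1 k) by [].
have WE' k : compop V2 (dsumop (idop H) U') k = V2 (dsumop (idop H) U' k) by [].
rewrite QE WE WE' UnE key WE' WE; congr (V2 _).
by move: (V1 _) => [a b]; rewrite !dsumopE /= UK.
Qed.

Lemma schaffer_comp (R : realType) (H : hilbertType R) (T1 T2 D1 D2 : 'B(H)) h xz :
  schaffer T1 D1 (schaffer T2 D2 (h, xz)) =
  (T1 (T2 h), (l2_col (compop D1 T2) D2 (l2_e0 h), 0) +
              dsumop pair_shift pair_shift xz).
Proof.
case: xz => -[x1 x2] [z1 z2]; rewrite (schafferE T2) (schafferE T1); congr pair.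
have -> : l2_col (compop D1 T2) D2 (l2_e0 h) =
    ((l2_e0 (D1 (T2 h)), l2_e0 (D2 h)) : hsum _ _).
  by apply: hsumP; rewrite -?(l2_amp_e0 D2) -?(l2_amp_e0 (compop D1 T2)).
apply: hsumP; apply: hsumP.
- by [].
- by [].
- exact/esym/add0r.
- exact/esym/add0r.
Qed.

(** Here [C = T1 T2], and the two columns of [edge_unitary_ex] are the operators
  that write the defect vectors of [T1 T2] and of [T2 T1 Q]. *)
Lemma edge_lift (R : realType) (H : hilbertType R) (T1 T2 Q : 'B(H)) :
  strictly_contractive T1 -> strictly_contractive T2 -> isometric Q ->
  (forall x, T1 (T2 x) = T2 (T1 (Q x))) ->
  exists (M : hilbertType R) (iota : bounded_op H M) (W1 W2 : 'B(M)),
    [/\ isometric iota, isolift iota T1 W1, isolift iota T2 W2 &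
        forall m, W1 (W2 m) = W2 (W1 (ext_id iota Q m))].
Proof.
move=> T1s T2s Qi comm.
have [D1 _ DD1] := defect_op_ex (strictly_contractiveW T1s).
have [D2 _ DD2] := defect_op_ex (strictly_contractiveW T2s).
have Cs := strictly_contractive_comp (strictly_contractiveW T1s) T2s.
have [x y|x y|U [U' [UK UK' Ui Ui' [Us Ua]]]] :=
  @edge_unitary_ex R H (compop D1 T2) D2 (compop D2 (compop T1 Q))
    (compop D1 Q) _ Cs.
- by rewrite /= DD1 DD2; lra.
- by rewrite /= DD1 DD2 !comm Qi; lra.
apply: (@edge_lift_of_unitary R H _ T1 T2 Q (schaffer T1 D1) (schaffer T2 D2)
  U U') => //.
- exact: schaffer_isometric.
- exact: schaffer_isometric.
move=> h n; rewrite (schaffer_comp T1) (schaffer_comp T2) comm.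
have -> : l2_col (compop D2 T1) D1 (l2_e0 (Q h)) =
    l2_col (compop D2 (compop T1 Q)) (compop D1 Q) (l2_e0 h).
  by apply: hsumP; rewrite [LHS]l2_amp_e0 [RHS]l2_amp_e0.
by rewrite -Ua -Us -linearD.
Qed.

(** * Extension of operators to larger spaces *)

Section Extensions.
Context {R : realType}.
Implicit Types H K M : hilbertType R.

Lemma adj_comp_inl H K M (iota : bounded_op H K) (x : hsum K M) :
  adj (compop inlop iota) x = adj iota x.1.
Proof.
apply/esym/(@adj_unique _ _ _ (compop inlop iota) (compop (adj iota) fstop)).
by move=> u v; rewrite -[LHS]/(rdot (inlop (iota u)) v) adjP inlop_adj adjP.
Qed.

Lemma isolift_dsum H K M (iota : bounded_op H K) (T : 'B(H)) (V : 'B(K))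
    (W : 'B(M)) : isolift iota T V -> isometric W ->
  isolift (compop inlop iota) T (dsumop V W).
Proof.
move=> [Vi pV] Wi; split; first exact: dsumop_isometric.
by move=> k; rewrite !adj_comp_inl dsumopE pV.
Qed.

Lemma ext_id_inl H K M (iota : bounded_op H K) (Q : 'B(H)) (x : hsum K M) :
  ext_id (compop inlop iota) Q x = (ext_id iota Q x.1, x.2).
Proof.
rewrite !ext_idE adj_comp_inl; apply: hsumP; first by [].
by rewrite [LHS]/= subr0 add0r.
Qed.

Lemma adj_ext_id H K (iota : bounded_op H K) (Q : 'B(H)) k : isometric iota ->
  adj iota (ext_id iota Q k) = Q (adj iota k).
Proof.
move=> iota_iso; rewrite ext_idE linearD linearB !(adj_isometric _ iota_iso).
by rewrite subrr addr0.
Qed.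

Lemma ext_id_isometric H K (iota : bounded_op H K) (Q : 'B(H)) :
  isometric iota -> isometric Q -> isometric (ext_id iota Q).
Proof.
move=> iota_iso Q_iso; apply: isometric_of_sqn => k.
rewrite ext_idE sqnD adjP linearB (adj_isometric _ iota_iso) subrr rdot0r.
rewrite !(sqn_isometric _ iota_iso) (sqn_isometric _ Q_iso) sqnB.
rewrite (sqn_isometric _ iota_iso) (rdotC k) adjP -/(sqn _).
lra.
Qed.

(** Schaffer's dilation would shift the second component even for an isometric
  [Q], so the extension is chosen to be [Q (+) I] in that case. *)
Lemma isometric_extension_ex H (Q : 'B(H)) : contractive Q ->
  exists Q0 : 'B(hsum H (l2 H)), [/\ isometric Q0, forall k, (Q0 k).1 = Q k.1 &
    isometric Q -> forall k, Q0 k = (Q k.1, k.2)].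
Proof.
move=> Qc; have [Qi|nQi] := pselect (isometric Q).
  by exists (dsumop Q (idop _)); split=> //; apply: dsumop_isometric.
have [D _ DD] := defect_op_ex Qc.
exists (pairop (compop Q fstop)
  (addop (compop l2_e0 (compop D fstop)) (compop l2_shift sndop))).
split=> //; apply: isometric_of_sqn => -[h y].
rewrite sqn_hsum [_.1]/= [_.2]/= sqn_e0_shift sqn_hsum /= /sqn DD.
lra.
Qed.

End Extensions.

(** * Growing a subtree by one vertex *)

Section Tree.
Context {V : finType} (G : simple_graph V).

Definition within (A : {set V}) : rel V := [rel x y | [&& x \in A, y \in A & G x y]].

Definition connected_in (A : {set V}) : Prop :=
  forall x y, x \in A -> y \in A -> connect (within A) x y.

Lemma within_path (A : {set V}) x p : x \in A -> path (within A) x p ->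
  path G x p /\ {subset x :: p <= A}.
Proof.
elim: p x => [|y p IH] x xA /=; first by split=> // z; rewrite inE => /eqP->.
move=> /andP[/and3P[_ yA xy] /(IH _ yA)[yp pA]]; split; first by rewrite xy.
by move=> z; rewrite inE => /predU1P[->|/pA].
Qed.

Lemma boundary_edge (A : {set V}) : connected_graph G ->
  A != finset.set0 -> A != finset.setT -> exists i j, [/\ i \in A, j \notin A & G i j].
Proof.
move=> [_ Gc] /set0Pn[x xA] AT.
have [z zA] : exists z, z \notin A.
  apply/existsP; apply: contraNT AT; rewrite negb_exists => /forallP h.
  by apply/eqP/finset.setP => z; rewrite inE; have := h z; rewrite negbK.
have [/existsP[i /existsP[j /and3P[iA jA ij]]]|h] :=
  boolP [exists i, exists j, [&& i \in A, j \notin A & G i j]].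
  by exists i, j.
have Acl : fingraph.closed G (mem A).
  move=> a b ab; apply/idP/idP => [aA|bA]; apply: contraNT h => nA.
    by apply/existsP; exists a; apply/existsP; exists b; rewrite aA nA ab.
  by apply/existsP; exists b; apply/existsP; exists a; rewrite bA nA adj_sym ab.
by have := closed_connect Acl (Gc x z); rewrite xA (negbTE zA).
Qed.

(** Two neighbours of [j] in [A] are joined by a simple path inside [A], and [j]
  would close it to a cycle. *)
Lemma boundary_edge_unique (A : {set V}) i i' j : acyclic_graph G ->
  connected_in A -> i \in A -> i' \in A -> j \notin A -> G i j -> G i' j -> i = i'.
Proof.
move=> Gac Ac iA i'A jA ij i'j; apply/eqP; apply: contraT => ii'.
have /connectP[p0 p0p] := Ac _ _ iA i'A; case/shortenP: p0p => p pp pu _ pl.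
have [ip pA] := within_path iA pp.
have : (size (j :: i :: p) < 3)%N.
  apply: Gac; apply/andP; split; last first.
    by rewrite [uniq _]/= -/(uniq (i :: p)) pu andbT; apply: contra jA => /pA.
  by rewrite /= adj_sym ij rcons_path ip -pl.
by case: p pl {pp pu ip pA} => //= /eqP; rewrite eq_sym (negbTE ii').
Qed.

Lemma connected_in_add (A : {set V}) i j : connected_in A -> i \in A -> G i j ->
  connected_in (j |: A)%SET.
Proof.
move=> Ac iA ij.
have sub x y : connect (within A) x y -> connect (within (j |: A)%SET) x y.
  apply: connect_sub => a b /and3P[aA bA ab]; apply: connect1.
  by rewrite /within /= !inE aA bA ab !orbT.
have csym : connect_sym (within (j |: A)%SET).
  by apply: sym_connect_sym => a b; rewrite /within /= andbCA adj_sym.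
have ci x : x \in (j |: A)%SET -> connect (within (j |: A)%SET) x i.
  rewrite !inE => /predU1P[->|xA]; last exact/sub/Ac.
  by apply: connect1; rewrite /within /= !inE eqxx iA adj_sym ij orbT.
by move=> x y xA yA; apply: connect_trans (ci x xA) _; rewrite csym ci.
Qed.

End Tree.

(** * The lifting theorem on a tree *)

Section TreeLift.
Context {R : realType} {H : hilbertType R} {n : nat} (G : simple_graph 'I_n).
Variables (Q : oedge G -> 'B(H)) (T : 'I_n -> 'B(H)).
Hypothesis Q_iso : forall e, isometric (Q e).
Hypothesis T_strict : forall i, strictly_contractive (T i).
Hypothesis T_comm : GQR_commuting Q T.

(** All vertices have lifts from the start, on a common space; the relations are
  obtained on larger and larger sets of vertices. *)
Definition lifted_on (A : {set 'I_n}) : Prop :=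
  exists (K : hilbertType R) (iota : bounded_op H K) (V : 'I_n -> 'B(K)),
    [/\ isometric iota, forall i, isolift iota (T i) (V i) &
        forall e, src e \in A -> tgt e \in A -> forall k,
          V (src e) (V (tgt e) k) = V (tgt e) (V (src e) (ext_id iota (Q e) k))].

Lemma oedge_eq (e e' : oedge G) : src e = src e' -> tgt e = tgt e' -> e = e'.
Proof.
rewrite /src /tgt => h1 h2; apply: val_inj.
by case: (val e) (val e') h1 h2 => [a b] [c d] /= -> ->.
Qed.

Lemma oedge_adj (e : oedge G) : G (src e) (tgt e).
Proof. by have /andP[] := valP e. Qed.

Lemma oedge_lt (e : oedge G) : (src e < tgt e)%N.
Proof. by have /andP[] := valP e. Qed.

Lemma lifted_on1 i : lifted_on [set i]%SET.
Proof.
have /choice[D DD] : forall l, exists D : 'B(H),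
    forall x y, rdot (D x) (D y) = rdot x y - rdot (T l x) (T l y).
  move=> l; have [D _ DD] := defect_op_ex (strictly_contractiveW (T_strict l)).
  by exists D.
exists (hsum H (hsum (hsum (l2 H) (l2 H)) (hsum (l2 H) (l2 H)))), inlop.
exists (fun l => schaffer (T l) (D l)); split.
- exact: inlop_isometric.
- move=> l; split; first exact: schaffer_isometric.
  by move=> k; rewrite !inlop_adj.
- move=> e; rewrite !finset.inE => /eqP si /eqP ti.
  by have := oedge_lt e; rewrite si ti ltnn.
Qed.

(** The orientation of the edge between [i] and [j] is given by the order of the
  vertices, so that either of them may come first in the relation. *)
Lemma edge_lift_either i j : G i j ->
  exists (M : hilbertType R) (iota : bounded_op H M) (W W2 : 'B(M)),
    [/\ isometric iota, isolift iota (T i) W, isolift iota (T j) W2,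
      forall e, src e = i -> tgt e = j ->
        forall m, W (W2 m) = W2 (W (ext_id iota (Q e) m)) &
      forall e, src e = j -> tgt e = i ->
        forall m, W2 (W m) = W (W2 (ext_id iota (Q e) m))].
Proof.
move=> ij; have [ltij|ltji|/val_inj eij] := ltngtP i j; last 1 first.
- by move: ij; rewrite eij adj_irrefl.
- have eP : G (i, j).1 (i, j).2 && ((i, j).1 < (i, j).2)%N by rewrite /= ij.
  pose e0 : oedge G := exist _ (i, j) eP.
  have [M [iota [W1 [W2 [iM l1 l2 h]]]]] :=
    edge_lift (T_strict i) (T_strict j) (Q_iso e0) (T_comm e0).
  exists M, iota, W1, W2; split=> // e se te.
    by have -> : e = e0 by apply: oedge_eq.
  by have := oedge_lt e; rewrite se te ltnNge ltnW.
- have eP : G (j, i).1 (j, i).2 && ((j, i).1 < (j, i).2)%N.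
    by rewrite /= adj_sym ij.
  pose e0 : oedge G := exist _ (j, i) eP.
  have [M [iota [W1 [W2 [iM l1 l2 h]]]]] :=
    edge_lift (T_strict j) (T_strict i) (Q_iso e0) (T_comm e0).
  exists M, iota, W2, W1; split=> // e se te; last first.
    by have -> : e = e0 by apply: oedge_eq.
  by have := oedge_lt e; rewrite se te ltnNge ltnW.
Qed.

(** Only one new relation involves [j], the one with its neighbour [i]: the lift
  of [j] is replaced by the one glued along [V i]. The other lifts are extended
  by the identity, and so they commute with [W] on [M]. *)
Lemma lifted_on_add (A : {set 'I_n}) i j : i \in A -> j \notin A -> G i j ->
  (forall i', i' \in A -> G i' j -> i' = i) ->
  lifted_on A -> lifted_on (j |: A)%SET.
Proof.
move=> iA jA ij uniq_i [K [iotaK [V [iK liftV relV]]]].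
have [M [iotaM [W [W2 [iM liftW liftW2 rel1 rel2]]]]] := edge_lift_either ij.
have [Vj [liftVj relj1 relj2]] :=
  amalgam (T_strict i) iK iM (liftV i) liftW liftW2.
have ji : j != i by apply: contraNneq jA => ->.
pose X l : 'B(M) := if l == i then W else idop M.
pose V' l := if l == j then Vj else dsumop (V l) (X l).
have Xi : X i = W by rewrite /X eqxx.
have Xiso l : isometric (X l).
  by rewrite /X; case: eqP => // _; case: liftW.
have V'j : V' j = Vj by rewrite /V' eqxx.
have V'A l : l \in A -> V' l = dsumop (V l) (X l).
  by move=> lA; rewrite /V'; case: eqP => // lj; rewrite lj (negbTE jA) in lA.
exists (hsum K M), (compop inlop iotaK), V'; split.
- exact: isometric_comp (@inlop_isometric R K M) iK.
- by move=> l; rewrite /V'; case: eqP => [->//|_]; apply: isolift_dsum.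
move=> e; rewrite !finset.inE.
have lt_e := oedge_lt e; have adj_e := oedge_adj e.
case/predU1P => [sj|sA] /predU1P[tj|tA] k.
- by move: lt_e; rewrite sj tj ltnn.
- have ti : tgt e = i by apply: uniq_i => //; rewrite adj_sym -sj.
  by rewrite sj ti V'j (V'A i iA) Xi; apply: relj2; apply: rel2.
- have si : src e = i by apply: uniq_i => //; rewrite -tj.
  by rewrite tj si V'j (V'A i iA) Xi; apply: relj1; apply: rel1.
rewrite !V'A// ext_id_inl !dsumopE relV//; congr pair.
rewrite /X; case: eqP => [si|_] //; case: eqP => [ti|_] //.
Qed.

Lemma tree_lift : connected_graph G -> acyclic_graph G -> lifted_on finset.setT.
Proof.
move=> Gc Gac; have [n0 _] := Gc.
have /card_gt0P[v _] := n0.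
suff grow m : (0 < m <= #|'I_n|)%N -> exists A : {set 'I_n},
    [/\ #|A| = m, connected_in G A & lifted_on A].
  have [|A [cA _ lA]] := grow #|'I_n|; first by rewrite n0 leqnn.
  suff -> : finset.setT = A by [].
  by apply/esym/eqP; rewrite finset.eqEcard finset.subsetT cA finset.cardsT leqnn.
elim: m => // m IH /andP[_ mn]; have [m0|m0] := posnP m.
  exists [set v]%SET; split; [by rewrite cards1 m0 | | exact: lifted_on1].
  by move=> x y; rewrite !finset.inE => /eqP -> /eqP ->; apply: connect0.
have [|A [cA Ac lA]] := IH; first by rewrite m0 ltnW.
have A0 : A != finset.set0 by rewrite -card_gt0 cA.
have AT : A != finset.setT.
  by apply: contraTneq mn => AE; rewrite -cA AE cardsT ltnn.
have [i [j [iA jA ij]]] := boundary_edge Gc A0 AT.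
exists (j |: A)%SET; split; first by rewrite cardsU1 jA cA.
  exact: connected_in_add Ac iA ij.
apply: (lifted_on_add iA jA ij _ lA) => i' i'A i'j.
exact: (boundary_edge_unique Gac Ac i'A iA jA i'j ij).
Qed.

End TreeLift.

(** * From the notions of the statement *)

Section Statement.
Context {R : realType}.
Implicit Types H K : hilbertType R.

Lemma contractiveP H (T : 'B(H)) : contraction_op T -> contractive T.
Proof.
move=> T1 x; apply: le_trans (opnorm_le T x) _.
by rewrite ler_piMl ?sqn_ge0// expr_le1 ?opnorm_ge0.
Qed.

Lemma strictly_contractiveP H (T : 'B(H)) :
  strict_contraction_op T -> strictly_contractive T.
Proof.
move=> T1; exists (opnorm T ^+ 2); last exact: opnorm_le.
by rewrite sqr_ge0 expr_lt1 ?opnorm_ge0.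
Qed.

Lemma unitary_isometric H (U : 'B(H)) : unitary_op U -> isometric U.
Proof. by move=> [Us [UUs UK _]] x y; rewrite /rdot UUs UK. Qed.

Lemma hdot_isometric H K (V : bounded_op H K) x y : isometric V ->
  hdot (V x) (V y) = hdot x y.
Proof. by move=> h; rewrite !hdot_rdot -linearZ !h. Qed.

Lemma isometry_opP H (V : 'B(H)) : isometric V -> isometry_op V.
Proof. by move=> h x y; exact: hdot_isometric. Qed.

Lemma is_isometric_liftP H K (iota : bounded_op H K) (T : 'B(H)) (V : 'B(K)) :
  isolift iota T V -> is_isometric_lift iota T V.
Proof.
move=> [Vi pV]; split; last exact: isometry_opP.
exists (adj T), (adj V); split; try exact: adj_is_adjoint.
exact: lift_adj.
Qed.

End Statement.

Theorem theorem8p8 (R : realType) (H : hilbertType R) (n : nat)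
    (G : simple_graph 'I_n)
    (G_connected : connected_graph G) (G_acyclic : acyclic_graph G)
    (Q : oedge G -> 'B(H)) (Q_contr : forall e, contraction_op (Q e))
    (T : 'I_n -> 'B(H)) (T_contr : forall i, strict_contraction_op (T i))
    (T_comm : GQR_commuting Q T) :
  exists (K : hilbertType R) (iota : {linear H -> K})
         (Qbar : oedge G -> 'B(K)) (V : 'I_n -> 'B(K)),
    [/\ hilbert_inclusion iota,
        forall e, is_isometric_lift iota (Q e) (Qbar e),
        forall i, is_isometric_lift iota (T i) (V i),
        GQR_commuting Qbar V &
        forall e, unitary_op (Q e) -> is_sum_id iota (Q e) (Qbar e)].
Proof.
have /choice[Q0 Q0P] := fun e => isometric_extension_ex (contractiveP (Q_contr e)).
have Q0_iso e : isometric (Q0 e) by case: (Q0P e).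
have Q0_fst e k : (Q0 e k).1 = Q e k.1 by case: (Q0P e).
(* the relations only involve the corner [H] of the isometric extensions *)
pose T0 i : 'B(hsum H (l2 H)) := dsumop (T i) (zeroop _ _).
have T0_strict i : strictly_contractive (T0 i).
  have [q q01 hq] := strictly_contractiveP (T_contr i); exists q => // k.
  rewrite dsumopE !sqn_hsum /= sqn0 addr0; apply: le_trans (hq _) _.
  by rewrite mulrDr lerDl mulr_ge0 ?sqn_ge0//; case/andP: q01.
have T0_comm : GQR_commuting Q0 T0.
  by move=> e k; rewrite !dsumopE /= T_comm Q0_fst.
have [K [iota [V [iota_iso V_lift V_comm]]]] :=
  tree_lift Q0_iso T0_strict T0_comm G_connected G_acyclic.
pose j := compop iota (@inlop R H (l2 H)).
have j_iso : isometric j by apply: isometric_comp => //; apply: inlop_isometric.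
have jE k : adj j k = (adj iota k).1.
  by apply: rdot_inj => h; rewrite adjPl -inlop_adj [RHS]adjPl [RHS]adjPl.
exists K, j, (fun e => ext_id iota (Q0 e)), V; split.
- by move=> x y; exact: hdot_isometric.
- move=> e; apply: is_isometric_liftP; split; first exact: ext_id_isometric.
  by move=> k; rewrite !jE adj_ext_id// Q0_fst.
- move=> i; apply: is_isometric_liftP; have [Vi pV] := V_lift i.
  by split=> // k; rewrite !jE pV.
- by move=> e k; apply: V_comm; rewrite finset.inE.
move=> e /unitary_isometric Qi; have [_ _ /(_ Qi) Q0E] := Q0P e.
have jh h : j h = iota (h, 0) by [].
split=> [h|k kj].
  by rewrite !jh ext_idE (adj_isometric _ iota_iso) Q0E /= subrr addr0.
have pk : (adj iota k).1 = 0.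
  by rewrite -jE; apply: rdot_inj => h; rewrite adjPl rdot0l /rdot kj.
rewrite ext_idE Q0E pk linear0.
have -> : (0, (adj iota k).2) = adj iota k by apply: hsumP.
by rewrite addrC subrK.
Qed.
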